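(* Let $FR_n$ denote the free rack on $n$ elements. Then $BFR_n$ has the homotopy type of $S^1\vee\cdots\vee S^1$, the wedge of $n$ copies of $S^1$.
   Context: A rack is a set $X$ with a binary operation $(a,b)\mapsto a^b$ such that $a\mapsto a^b$ is a bijection for each $b$ and $(a^b)^c=(a^c)^{(b^c)}$. The free rack on a set $S$ (with universal property for maps from $S$ to racks) is $S\times F(S)$, $F(S)$ the free group on $S$, elements written $a^w$, with operation $(a^w)^{(b^u)}=a^{wu^{-1}bu}$. With $\delta_i^\varepsilon:I^{k-1}\to I^k$ ($I=[0,1]$, $\varepsilon\in\{0,1\}$) inserting $\varepsilon$ as $i$-th coordinate, the rack space of $X$ is the CW complex $BX=\coprod_k X^k\times I^k/\big((\partial_i^\varepsilon x,t)\sim(x,\delta_i^\varepsilon t)\big)$, where $\partial_i^0(x_1,\dots,x_k)=(x_1,\dots,\widehat{x_i},\dots,x_k)$ and $\partial_i^1(x_1,\dots,x_k)=(x_1^{x_i},\dots,x_{i-1}^{x_i},x_{i+1},\dots,x_k)$. *)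

(* Defs.v *)
From HB Require Import structures.
From Stdlib Require Import Relation_Operators.
From mathcomp Require Import all_boot all_order all_algebra generic_quotient.
From mathcomp Require Import all_classical all_reals topology homotopy normedtype.

Set Implicit Arguments.
Unset Strict Implicit.
Unset Printing Implicit Defensive.

Import Order.TTheory GRing.Theory Num.Theory numFieldNormedType.Exports.

Local Open Scope classical_set_scope.
Local Open Scope ring_scope.
Local Open Scope quotient_scope.

(* [rack_op a b] is $a^b$. *)
HB.mixin Record isRack X := {
  rack_op : X -> X -> X;
  rack_op_bij : forall b, bijective (rack_op^~ b);
  rack_opD : forall a b c,
    rack_op (rack_op a b) c = rack_op (rack_op a c) (rack_op b c)
}.

#[short(type="rackType")]
HB.structure Definition Rack := {X of isRack X & Choice X}.

Section FreeGroup.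
Variable S : choiceType.

(* [(s, false)] stands for the generator s and [(s, true)] for its inverse. *)
Local Notation letter := (S * bool)%type.
Implicit Types (a b : letter) (u v w : seq letter).

Definition inv_letter a : letter := (a.1, ~~ a.2).

Definition reduced : pred (seq letter) := sorted (fun a b => b != inv_letter a).

Definition push a w : seq letter :=
  if w is b :: w' then if b == inv_letter a then w' else a :: w else [:: a].

(* Reduced form of the concatenation [u ++ v], for [v] reduced. *)
Definition word_mul u v : seq letter := foldr push v u.

Definition word_inv u : seq letter := rev [seq inv_letter a | a <- u].

Lemma inv_letterK : involutive inv_letter.
Proof. by case=> s e; rewrite /inv_letter /= negbK. Qed.

Lemma reduced_push a w : reduced w -> reduced (push a w).
Proof.
case: w => [|b w] //= rw; case: eqVneq => [_|ba]; first exact: path_sorted rw.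
by rewrite /= ba.
Qed.

Lemma reduced_mul u v : reduced v -> reduced (word_mul u v).
Proof. by move=> rv; elim: u => //= a u; exact: reduced_push. Qed.

Lemma reduced_inv u : reduced u -> reduced (word_inv u).
Proof.
rewrite /reduced /word_inv rev_sorted sorted_map; apply: sub_sorted => a b /=.
by rewrite inv_letterK eq_sym (can2_eq inv_letterK inv_letterK).
Qed.

Lemma pushK a w : reduced w -> push (inv_letter a) (push a w) = w.
Proof.
case: w => [|b w] /=; first by rewrite inv_letterK eqxx.
case: eqVneq => [->|_ _] /=; last by rewrite inv_letterK eqxx.
case: w => [|c w] //= /andP[+ _].
by case: eqVneq.
Qed.

Lemma word_mul_push a u v : reduced v ->
  word_mul (push a u) v = push a (word_mul u v).
Proof.
move=> rv; case: u => [|b u] //=; case: eqVneq => [->|//].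
by have := pushK (inv_letter a) (reduced_mul u rv); rewrite inv_letterK.
Qed.

Lemma word_mulA u v w : reduced w ->
  word_mul u (word_mul v w) = word_mul (word_mul u v) w.
Proof. by move=> rw; elim: u => //= a u ->; rewrite word_mul_push. Qed.

Lemma word_mul0 u : reduced u -> word_mul u [::] = u.
Proof.
elim: u => //= a u IHu rau; rewrite IHu; last exact: path_sorted rau.
by case: u rau {IHu} => //= b u /andP[/negPf ->].
Qed.

Lemma word_mulV u : reduced u -> word_mul (word_inv u) u = [::].
Proof.
elim: u => //= a u IHu rau; rewrite /word_inv map_cons rev_cons.
rewrite /word_mul foldr_rcons /= inv_letterK eqxx.
by apply: IHu; exact: path_sorted rau.
Qed.

Lemma word_invK : involutive word_inv.
Proof.
by move=> u; rewrite /word_inv map_rev revK mapK //; exact: inv_letterK.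
Qed.

Record free_group := FreeGroup {
  word :> seq letter;
  word_reduced : reduced word
}.

HB.instance Definition _ := [isSub for word].
HB.instance Definition _ := [Choice of free_group by <:].

Definition fg_one : free_group := @FreeGroup [::] isT.

Definition fg_mul (x y : free_group) : free_group :=
  FreeGroup (reduced_mul x (word_reduced y)).

Definition fg_inv (x : free_group) : free_group :=
  FreeGroup (reduced_inv (word_reduced x)).

Definition fg_gen (s : S) : free_group := @FreeGroup [:: (s, false)] isT.

Lemma fg_mulA : associative fg_mul.
Proof. by move=> x y z; apply: val_inj; apply: word_mulA (word_reduced z). Qed.

Lemma fg_mul1g : left_id fg_one fg_mul.
Proof. by move=> x; exact: val_inj. Qed.

Lemma fg_mulg1 : right_id fg_one fg_mul.
Proof. by move=> x; apply: val_inj; exact: word_mul0 (word_reduced x). Qed.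

Lemma fg_mulVg : left_inverse fg_one fg_inv fg_mul.
Proof. by move=> x; apply: val_inj; exact: word_mulV (word_reduced x). Qed.

Lemma fg_invK : involutive fg_inv.
Proof. by move=> x; apply: val_inj; exact: word_invK. Qed.

Lemma fg_mulgV : right_inverse fg_one fg_inv fg_mul.
Proof. by move=> x; rewrite -{1}[x]fg_invK fg_mulVg. Qed.

HB.instance Definition _ := isGroup.Build free_group
  fg_mulA fg_mul1g fg_mulg1 fg_mulVg fg_mulgV.

End FreeGroup.

Section FreeRack.
Variable S : choiceType.
Local Open Scope group_scope.

(* [(a, w)] is $a^w$. *)
Definition free_rack : Type := (S * free_group S)%type.

HB.instance Definition _ := Choice.on free_rack.

Definition free_rack_op (x y : free_rack) : free_rack :=
  (x.1, x.2 * y.2^-1 * fg_gen y.1 * y.2).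

Lemma free_rack_op_bij y : bijective (free_rack_op^~ y).
Proof.
exists (fun x => (x.1, x.2 * y.2^-1 * (fg_gen y.1)^-1 * y.2)) => -[s w];
  by congr pair; rewrite /= !(mulgK, mulgVK).
Qed.

Lemma free_rack_opD x y z :
  free_rack_op (free_rack_op x y) z =
  free_rack_op (free_rack_op x z) (free_rack_op y z).
Proof.
by congr pair; rewrite /= !invgM invgK !mulgA !(mulgK, mulgVK).
Qed.

HB.instance Definition _ := isRack.Build free_rack free_rack_op_bij free_rack_opD.

End FreeRack.

Section Homotopy.
Variable R : realType.

Definition unit_interval : set R := [set` `[0, 1]].

Lemma endpoint_subproof (e : bool) : (e%:R : R) \in unit_interval.
Proof. by rewrite inE /unit_interval /= in_itv /= ler0n lern1 leq_b1. Qed.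

Definition endpoint (e : bool) : unit_interval :=
  exist _ (e%:R : R) (endpoint_subproof e).

Definition homotopic (X Y : topologicalType) (f g : X -> Y) : Prop :=
  exists H : X * unit_interval -> Y,
    [/\ continuous H,
        forall x, H (x, endpoint false) = f x
      & forall x, H (x, endpoint true) = g x].

Definition homotopy_equivalent (X Y : topologicalType) : Prop :=
  exists (f : X -> Y) (g : Y -> X),
    [/\ continuous f, continuous g,
        homotopic (g \o f) idfun & homotopic (f \o g) idfun].

End Homotopy.

Arguments unit_interval R : clear implicits.

Section RackSpace.
Variables (R : realType) (X : rackType).

Definition cube (k : nat) : topologicalType :=
  {ptws 'I_k -> unit_interval R}.

(* $\delta_i^\varepsilon : I^k \to I^{k+1}$ *)
Definition coface (e : bool) k (i : 'I_k.+1) (t : cube k) : cube k.+1 :=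
  fun j => if unlift i j is Some j' then t j' else endpoint R e.

(* $\partial_i^\varepsilon : X^{k+1} \to X^k$ *)
Definition face (e : bool) k (i : 'I_k.+1) (x : {ffun 'I_k.+1 -> X}) :
    {ffun 'I_k -> X} :=
  [ffun j => if e && (lift i j < i)%N then rack_op (x (lift i j)) (x i)
             else x (lift i j)].

(* $\coprod_k X^k \times I^k$, with $X^k$ discrete. *)
Definition rack_cells : topologicalType :=
  {k : nat & (discrete_topology {ffun 'I_k -> X} * cube k)%type}.

Definition rack_cell k (x : {ffun 'I_k -> X}) (t : cube k) : rack_cells :=
  existT _ k (x : discrete_topology {ffun 'I_k -> X}, t).

Inductive rack_glue : rack_cells -> rack_cells -> Prop :=
  RackGlue (e : bool) k (i : 'I_k.+1) (x : {ffun 'I_k.+1 -> X}) (t : cube k) :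
    rack_glue (rack_cell (face e i x) t) (rack_cell x (coface e i t)).

Definition rack_space_rel_def (p q : rack_cells) : bool :=
  `[< clos_refl_sym_trans rack_cells rack_glue p q >].

Lemma rack_space_rel_refl : reflexive rack_space_rel_def.
Proof. by move=> p; apply/asboolP; exact: rst_refl. Qed.

Lemma rack_space_rel_sym : symmetric rack_space_rel_def.
Proof.
by move=> p q; apply/asboolP/asboolP; exact: rst_sym.
Qed.

Lemma rack_space_rel_trans : transitive rack_space_rel_def.
Proof.
by move=> q p r /asboolP pq /asboolP qr; apply/asboolP; exact: rst_trans pq qr.
Qed.

Definition rack_space_rel :=
  EquivRel _ rack_space_rel_refl rack_space_rel_sym rack_space_rel_trans.

Definition rack_space : Type := {eq_quot rack_space_rel}.

HB.instance Definition _ :=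
  Topological.copy rack_space (quotient_topology rack_space).
HB.instance Definition _ := Quotient.on rack_space.

End RackSpace.

Section Circles.
Variable R : realType.

Definition circle : set (R * R) := [set z | z.1 ^+ 2 + z.2 ^+ 2 = 1].

Lemma circle_base_subproof : ((1, 0) : R * R) \in circle.
Proof. by rewrite inE /circle /= expr1n expr0n addr0. Qed.

Definition circle_base : circle := exist _ (1, 0) circle_base_subproof.

(* The library's [wedge] over an empty index type is empty, whereas the wedge of
   no pointed spaces is a point. *)
Definition circle_wedge (n : nat) : topologicalType :=
  if n is m.+1 then wedge (fun _ : 'I_m.+1 => circle_base)
  else discrete_topology unit.

End Circles.

Arguments circle R : clear implicits.

(* Main.v *)
(** Let F be the free group on S. It acts on the right of the free rack by
    [(s, w) b = (s, w b)], and on the left of its Cayley tree T, whose edges run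
    from [a] to [a s]. For a k-tuple x and [t] in the k-cube, the points
    [[x a; t]] and [[x a, (s, 1); t, u]] form a copy of T in the rack space, so
    that each cell x spans a family [cube x T -> BX]; on the face [t_k = 1] this
    family is the one of [(x_1, ..., x_(k-1))], translated by
    [w_k^-1 s_k w_k].

    Since T contracts to a point, [I x T] can be pushed into
    [0 x T  U  1 x T  U  I x point], the point being the vertex where the last
    entry of the tuple becomes [(s_k, 1)]. Both ends belong to the tree family
    of the shorter tuple, and the middle part is an edge of it: this removes the
    last coordinate of the cube. Iterating, everything is pushed into the tree
    family of the empty tuple, which is F\T, the wedge of circles. The time
    allotted to the i-th push vanishes when [t_i] is 0 or 1, which makes these
    homotopies compatible with the face identifications. *)

Require Import Defs.
From HB Require Import structures.
From Stdlib Require Import Relation_Operators.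
From mathcomp Require Import mathcomp_extra unstable.
From mathcomp Require Import all_boot all_order all_algebra generic_quotient.
From mathcomp Require Import all_classical all_reals topology homotopy.
From mathcomp Require Import normedtype realfun.
From mathcomp Require Import zify ring lra.

Set Implicit Arguments.
Unset Strict Implicit.
Unset Printing Implicit Defensive.

Import Order.TTheory GRing.Theory Num.Theory numFieldNormedType.Exports.

Local Open Scope classical_set_scope.
Local Open Scope ring_scope.
Local Open Scope quotient_scope.

(** * Continuity of piecewise maps and of maps on discrete products *)

Section Continuity.
Implicit Types X Y Z K : topologicalType.

Lemma continuous_cst X Y (y : Y) : continuous (fun _ : X => y).
Proof. exact: cst_continuous. Qed.

Lemma continuous_id X : continuous (fun x : X => x).
Proof. by move=> x; exact: cvg_id. Qed.

Lemma continuous_pair X Y Z (f : X -> Y) (g : X -> Z) :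
  continuous f -> continuous g -> continuous (fun x => (f x, g x)).
Proof. by move=> cf cg x; apply: cvg_pair; [exact: cf|exact: cg]. Qed.

Lemma continuous_fst X Y : continuous (@fst X Y).
Proof. by move=> x; exact: cvg_fst. Qed.

Lemma continuous_snd X Y : continuous (@snd X Y).
Proof. by move=> x; exact: cvg_snd. Qed.

Lemma continuous_compose X Y Z (f : X -> Y) (g : Y -> Z) :
  continuous f -> continuous g -> continuous (fun x => g (f x)).
Proof. by move=> cf cg x; apply: continuous_comp; [exact: cf|exact: cg]. Qed.

Lemma continuous_eq X Y (f g : X -> Y) :
  f =1 g -> continuous g -> continuous f.
Proof. by move=> /funext ->. Qed.

(** Where [a] and [b] differ, only one branch matters nearby; where they agree, both branches have
    the same value, so the preimages under both are neighbourhoods. *)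
Lemma continuous_if (R : realType) X Y (a b : X -> R) (f g : X -> Y) :
  continuous a -> continuous b -> continuous f -> continuous g ->
  (forall x, a x = b x -> f x = g x) ->
  continuous (fun x => if a x < b x then f x else g x).
Proof.
move=> ca cb cf cg fg x.
have open_lt (c d : X -> R) : continuous c -> continuous d -> c x < d x ->
    \forall y \near x, c y < d y.
  move=> cc cd cdx; have : {for x, continuous (fun y => d y - c y)}.
    by apply: continuousB; [exact: cd|exact: cc].
  move=> /(@cvgr_gt _ _ _ _ _ (d x - c x)) /(_ 0); rewrite subr_gt0 => /(_ cdx).
  by apply: filterS => y; rewrite subr_gt0.
move=> U; rewrite nbhs_simpl; have [ab|ba|ab] := ltgtP (a x) (b x) => /= xU.
- have fV : nbhs x (f @^-1` U) := cf x U xU.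
  by apply: filterS2 fV (open_lt _ _ ca cb ab) => y /= ? ->.
- have gV : nbhs x (g @^-1` U) := cg x U xU.
  apply: filterS2 gV (open_lt _ _ cb ca ba) => y /= ? /ltW.
  by rewrite leNgt => /negPf ->.
- have gV : nbhs x (g @^-1` U) := cg x U xU.
  have fV : nbhs x (f @^-1` U) by apply: cf; rewrite fg.
  by apply: filterS2 fV gV => y /= fy gy; case: ifP.
Qed.

Lemma discrete_prod_continuous (A : choiceType) Y Z
    (f : discrete_topology A * Y -> Z) :
  (forall a, continuous (fun y => f (a, y))) -> continuous f.
Proof.
move=> cf [a y] U fU.
have V : nbhs y ((fun y => f (a, y)) @^-1` U) := cf a y U fU.
exists ([set a], [set y' | U (f (a, y'))]).
  by split => //=; exact: discrete_set1.
by move=> [b y'] /= [-> ].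
Qed.

End Continuity.

(** * The unit interval and the cubes as compact Hausdorff spaces *)

Section Interval.
Variable R : realType.
Local Notation I := (unit_interval R).

Lemma clamp_subproof (r : R) : Num.max 0 (Num.min r 1) \in I.
Proof.
rewrite inE /unit_interval /= in_itv /= le_max lexx /= ge_max ler01 /=.
by rewrite ge_min lexx orbT.
Qed.

(** The retraction of the line onto the interval; it lets paths be given by real formulas without
    carrying bounds. *)
Definition clamp (r : R) : I :=
  exist _ (Num.max 0 (Num.min r 1) : R) (clamp_subproof r).

Lemma itv_ge0 (t : I) : 0 <= \val t.
Proof. by case: t => t /=; rewrite inE /unit_interval /= in_itv => /andP[]. Qed.

Lemma itv_le1 (t : I) : \val t <= 1.
Proof. by case: t => t /=; rewrite inE /unit_interval /= in_itv => /andP[]. Qed.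

Lemma clampE (r : R) : 0 <= r <= 1 -> \val (clamp r) = r.
Proof. by move=> /andP[r0 r1]; rewrite /= (min_idPl r1); apply/max_idPr. Qed.

Lemma clamp_le0 (r : R) : r <= 0 -> clamp r = endpoint R false.
Proof.
move=> r0; apply: val_inj => /=; rewrite min_l; last exact: le_trans ler01.
exact/max_idPl.
Qed.

Lemma clamp_ge1 (r : R) : 1 <= r -> clamp r = endpoint R true.
Proof. by move=> r1; apply: val_inj => /=; rewrite min_r // max_r. Qed.

Lemma clamp_val (t : I) : clamp (\val t) = t.
Proof. by apply: val_inj; rewrite clampE // itv_ge0 itv_le1. Qed.

Lemma continuous_val : continuous (\val : I -> R).
Proof. exact: initial_continuous. Qed.

Section RealFunctions.
Variables (X : topologicalType) (f g : X -> R).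
Hypotheses (cf : continuous f) (cg : continuous g).

Lemma continuous_add : continuous (fun x => f x + g x).
Proof. by move=> x; apply: continuousD; [exact: cf|exact: cg]. Qed.

Lemma continuous_sub : continuous (fun x => f x - g x).
Proof. by move=> x; apply: continuousB; [exact: cf|exact: cg]. Qed.

Lemma continuous_mul : continuous (fun x => f x * g x).
Proof. by move=> x; apply: continuousM; [exact: cf|exact: cg]. Qed.

Lemma continuous_maxr : continuous (fun x => Num.max (f x) (g x)).
Proof.
by move=> x; apply: (@continuous_max R X f g); [exact: cf|exact: cg].
Qed.

Lemma continuous_minr : continuous (fun x => Num.min (f x) (g x)).
Proof.
by move=> x; apply: (@continuous_min R X f g); [exact: cf|exact: cg].
Qed.

End RealFunctions.

Lemma continuous_clamp : continuous clamp.
Proof.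
apply: continuous_comp_initial => /=.
apply: continuous_maxr; first exact: continuous_cst.
by apply: continuous_minr; [exact: continuous_id|exact: continuous_cst].
Qed.

Lemma compact_interval : compact [set: I].
Proof.
have -> : [set: I] = clamp @` `[0, 1].
  rewrite eqEsubset; split => // t _; exists (\val t); last exact: clamp_val.
  by rewrite /= in_itv /= itv_ge0 itv_le1.
apply: continuous_compact; last exact: segment_compact.
exact/continuous_subspaceT/continuous_clamp.
Qed.

Lemma hausdorff_interval : hausdorff_space I.
Proof.
move=> s t st; apply: val_inj; apply: (@Rhausdorff R) => U V sU tV.
have sU' : nbhs s (\val @^-1` U) by exact: continuous_val.
have tV' : nbhs t (\val @^-1` V) by exact: continuous_val.
by have [u []] := st _ _ sU' tV'; exists (\val u).
Qed.

Lemma compact_cube k : compact [set: cube R k].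
Proof.
have := @tychonoff 'I_k (fun=> I) (fun=> setT) (fun=> compact_interval).
by congr (compact _); rewrite eqEsubset.
Qed.

Lemma hausdorff_cube k : hausdorff_space (cube R k).
Proof. apply: hausdorff_product => _; exact: hausdorff_interval. Qed.

End Interval.

(** * Maps out of the rack space *)

Section Quotients.
Implicit Types (K Y : topologicalType).

(** The exponential law. When [Q] is a quotient it allows continuity on [Q * K] to be tested on
    cells, although the product of a quotient map with the identity of a general space need not be a
    quotient map. *)
Lemma uncurried_continuous (Q K Y : topologicalType) (h : Q * K -> Y) :
  compact [set: K] -> hausdorff_space K ->
  continuous (curry h : Q -> {compact-open, K -> Y}) ->
  (forall q, continuous (fun x => h (q, x))) -> continuous h.
Proof.
move=> cK hK ch chq; rewrite -[h]curryK; apply: continuous_uncurry => //.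
by move=> x _; exists setT; [exact: filterT|split => //; exact: closedT].
Qed.

Variables (R : realType) (X : rackType).
Local Notation B := (rack_space R X).

Definition rack_point k (x : {ffun 'I_k -> X}) (t : cube R k) : B :=
  \pi_(rack_space R X) (rack_cell x t).

Lemma rack_pointP (b : B) :
  exists k (x : {ffun 'I_k -> X}) t, b = rack_point x t.
Proof. by rewrite -[b]reprK; case: (repr b) => k [x t]; exists k, x, t. Qed.

Lemma rack_space_continuous Y (h : B -> Y) :
  (forall k (x : {ffun 'I_k -> X}), continuous (fun t => h (rack_point x t))) ->
  continuous h.
Proof.
move=> ch; apply/quotient_continuous.
have -> : h \o \pi_(rack_space R X) =
    sigT_fun (fun k (p : discrete_topology {ffun 'I_k -> X} * cube R k) =>
                h (rack_point p.1 p.2)).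
  by apply/funext => -[k [x t]].
by apply: sigT_continuous => k; apply: discrete_prod_continuous; exact: ch.
Qed.

Lemma rack_point_continuous k (x : {ffun 'I_k -> X}) :
  continuous (rack_point x).
Proof.
apply: (@continuous_compose _ _ _ (rack_cell x)); last exact: pi_continuous.
apply: (@continuous_compose _ _ _ (fun t => (x : discrete_topology _, t)));
  last exact: existT_continuous.
by apply: continuous_pair; [exact: continuous_cst|exact: continuous_id].
Qed.

Lemma rack_space_prod_continuous K Y (h : B * K -> Y) :
  compact [set: K] -> hausdorff_space K ->
  (forall k (x : {ffun 'I_k -> X}),
     continuous (fun p : cube R k * K => h (rack_point x p.1, p.2))) ->
  continuous h.
Proof.
move=> cK hK ch; apply: uncurried_continuous => // [|q].
  by apply: rack_space_continuous => k x; case/continuous_curry: (ch k x).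
have [k [x [t ->]]] := rack_pointP q.
apply: (@continuous_compose _ _ _ (fun y => (t, y)) _ _ (ch k x)).
by apply: continuous_pair; [exact: continuous_cst|exact: continuous_id].
Qed.

Lemma rack_point_face (e : bool) k (i : 'I_k.+1) (x : {ffun 'I_k.+1 -> X}) t :
  rack_point (face e i x) t = rack_point x (coface e i t).
Proof. by apply/eqmodP/asboolP; apply: rst_step; exact: RackGlue. Qed.

(** Evaluates [f] on a chosen representative. Compatibility with the faces is left to [rack_liftE],
    where it propagates along the equivalence closure. *)
Definition rack_lift Y (f : forall k, {ffun 'I_k -> X} -> cube R k -> Y)
    (b : B) : Y :=
  f _ (projT2 (repr b)).1 (projT2 (repr b)).2.

Lemma rack_liftE Y (f : forall k, {ffun 'I_k -> X} -> cube R k -> Y) :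
  (forall e k (i : 'I_k.+1) x t,
     f k (face e i x) t = f k.+1 x (coface e i t)) ->
  forall k x t, rack_lift f (@rack_point k x t) = f k x t.
Proof.
move=> ff k x t; rewrite /rack_lift /rack_point; case: piP => p /eqmodP/asboolP.
have -> : f k x t = f (projT1 (rack_cell x t)) (projT2 (rack_cell x t)).1
  (projT2 (rack_cell x t)).2 by [].
elim=> [p1 p2 []|//|p1 p2 _ -> //|p1 p2 p3 _ -> _ -> //].
by move=> e m i y s; exact/esym/ff.
Qed.

End Quotients.

(** * Reduced words and multiplication by a generator *)

Section Letters.
Variable S : choiceType.
Local Notation F := (free_group S).
Local Open Scope group_scope.

Definition option_gen (o : option S) : F := if o is Some s then fg_gen s else 1.

Definition letter_gen (l : S * bool) : F :=
  if l.2 then (fg_gen l.1)^-1 else fg_gen l.1.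

Definition word_gen (u : seq (S * bool)) : F :=
  foldr (fun l g => letter_gen l * g) 1 u.

Lemma word_letter_gen l (g : F) : word (letter_gen l * g) = push l (word g).
Proof. by case: l => s []. Qed.

Lemma word_word_gen u : reduced u -> word (word_gen u) = u.
Proof.
elim: u => // l u IHu lu.
rewrite word_letter_gen IHu; last exact: path_sorted lu.
by case: u lu {IHu} => //= m u /andP[/negPf ->].
Qed.

Lemma word_genK (a : F) : word_gen (word a) = a.
Proof. by apply: val_inj; apply: word_word_gen; exact: word_reduced. Qed.

Lemma word_gen_rcons u l : word_gen (rcons u l) = word_gen u * letter_gen l.
Proof. by elim: u => [|m u IHu] /=; rewrite ?mulg1 ?mul1g // IHu mulgA. Qed.

(** The two cases say whether the edge from [a] to [a s] of the Cayley tree leads towards the root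
    or away from it. The default [(s, false)] of [last] puts the empty word in the second case. *)
Lemma word_mul_gen (a : F) s :
  (exists2 u, word a = rcons u (s, true) & word (a * fg_gen s) = u) \/
  (last (s, false) (word a) != (s, true) /\
   word (a * fg_gen s) = rcons (word a) (s, false)).
Proof.
have [e|ne] := eqVneq (last (s, false) (word a)) (s, true); [left|right].
- case/lastP: (word a) (word_reduced a) (word_genK a) e => [//|u l] ru ua.
  rewrite last_rcons => le; rewrite {}le in ru ua *; exists u => //.
  have -> : a * fg_gen s = word_gen u by rewrite -ua word_gen_rcons /= mulgVK.
  apply: word_word_gen; move: ru; rewrite /reduced -cats1.
  by case/cat_sorted2.
- split=> //.
  have -> : a * fg_gen s = word_gen (rcons (word a) (s, false)).
    by rewrite word_gen_rcons word_genK.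
  apply: word_word_gen; rewrite /reduced.
  have := word_reduced a; rewrite /reduced; case: (word a) ne => //= l u ne.
  move=> lu; rewrite rcons_path lu /=; apply: contra_neq ne => e.
  by rewrite -[last l u]inv_letterK -e.
Qed.

End Letters.

(** * The Cayley tree of the free group and its contraction *)

Section Tree.
Variables (R : realType) (S : choiceType).
Local Notation F := (free_group S).
Local Notation I := (unit_interval R).
Local Notation end0 := (endpoint R false).
Local Notation end1 := (endpoint R true).

(* [(a, Some s, u)] is the point at distance u on the edge from a to a s; the
   intervals labelled [None] are collapsed to vertices, so that T has vertices
   even if S is empty. *)
Definition tree_cells : topologicalType :=
  (discrete_topology (F * option S)%type * I)%type.

Definition tree_cell (a : F) (o : option S) (u : I) : tree_cells :=
  ((a, o) : discrete_topology _, u).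

Inductive tree_glue : tree_cells -> tree_cells -> Prop :=
| TreeSource a o : tree_glue (tree_cell a None end0) (tree_cell a o end0)
| TreeTarget a o :
    tree_glue (tree_cell (a * option_gen o)%g None end0) (tree_cell a o end1)
| TreeVertex a u : tree_glue (tree_cell a None end0) (tree_cell a None u).

Definition tree_rel_def (p q : tree_cells) : bool :=
  `[< clos_refl_sym_trans tree_cells tree_glue p q >].

Lemma tree_rel_refl : reflexive tree_rel_def.
Proof. by move=> p; apply/asboolP; exact: rst_refl. Qed.

Lemma tree_rel_sym : symmetric tree_rel_def.
Proof. by move=> p q; apply/asboolP/asboolP; exact: rst_sym. Qed.

Lemma tree_rel_trans : transitive tree_rel_def.
Proof.
by move=> q p r /asboolP pq /asboolP qr; apply/asboolP; exact: rst_trans pq qr.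
Qed.

Definition tree_rel := EquivRel _ tree_rel_refl tree_rel_sym tree_rel_trans.

Definition tree : Type := {eq_quot tree_rel}.

HB.instance Definition _ := Topological.copy tree (quotient_topology tree).
HB.instance Definition _ := Quotient.on tree.

Definition tree_point (a : F) (o : option S) (u : I) : tree :=
  \pi_tree (tree_cell a o u).

Definition vertex (a : F) : tree := tree_point a None end0.

Lemma tree_point_source a o : tree_point a o end0 = vertex a.
Proof.
by apply/esym/eqmodP/asboolP; apply: rst_step; exact: TreeSource.
Qed.

Lemma tree_point_target a o :
  tree_point a o end1 = vertex (a * option_gen o)%g.
Proof.
by apply/esym/eqmodP/asboolP; apply: rst_step; exact: TreeTarget.
Qed.

Lemma tree_point_vertex a u : tree_point a None u = vertex a.
Proof.
by apply/esym/eqmodP/asboolP; apply: rst_step; exact: TreeVertex.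
Qed.

Lemma tree_pointP (p : tree) : exists a o u, p = tree_point a o u.
Proof.
by rewrite -[p]reprK; case: (repr p) => [[a o] u]; exists a, o, u.
Qed.

Lemma tree_point_continuous a o : continuous (tree_point a o).
Proof.
apply: (@continuous_compose _ _ _ (tree_cell a o)); last exact: pi_continuous.
by apply: continuous_pair; [exact: continuous_cst|exact: continuous_id].
Qed.

Lemma tree_continuous (Y : topologicalType) (h : tree -> Y) :
  (forall a o, continuous (fun u => h (tree_point a o u))) -> continuous h.
Proof.
move=> ch; apply/quotient_continuous.
by apply: discrete_prod_continuous => -[a o]; exact: ch.
Qed.

Lemma tree_prod_continuous (K Y : topologicalType) (h : tree * K -> Y) :
  compact [set: K] -> hausdorff_space K ->
  (forall a o, continuous (fun p : I * K => h (tree_point a o p.1, p.2))) ->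
  continuous h.
Proof.
move=> cK hK ch; apply: uncurried_continuous => // [|q].
  by apply: tree_continuous => a o; case/continuous_curry: (ch a o).
have [a [o [u ->]]] := tree_pointP q.
apply: (@continuous_compose _ _ _ (fun y => (u, y)) _ _ (ch a o)).
by apply: continuous_pair; [exact: continuous_cst|exact: continuous_id].
Qed.

Definition tree_lift Y (f : F -> option S -> I -> Y) (p : tree) : Y :=
  f (repr p).1.1 (repr p).1.2 (repr p).2.

Lemma tree_liftE Y (f : F -> option S -> I -> Y) :
  (forall a o, f a o end0 = f a None end0) ->
  (forall a o, f a o end1 = f (a * option_gen o)%g None end0) ->
  (forall a u, f a None u = f a None end0) ->
  forall a o u, tree_lift f (tree_point a o u) = f a o u.
Proof.
move=> f0 f1 fN a o u; rewrite /tree_lift /tree_point.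
case: piP => p /eqmodP/asboolP.
have -> : f a o u = f (tree_cell a o u).1.1 (tree_cell a o u).1.2
  (tree_cell a o u).2 by [].
elim=> [p1 p2 []|//|p1 p2 _ -> //|p1 p2 p3 _ -> _ -> //] /= *;
  by rewrite ?f0 ?f1 ?[in RHS]fN // fN.
Qed.

Definition tree_act (b : F) : tree -> tree :=
  tree_lift (fun a o u => tree_point (b * a)%g o u).

Lemma tree_act_point b a o u :
  tree_act b (tree_point a o u) = tree_point (b * a)%g o u.
Proof.
apply: tree_liftE => *; rewrite ?tree_point_source ?tree_point_target ?mulgA //.
by rewrite !tree_point_vertex.
Qed.

Lemma tree_act_vertex b a : tree_act b (vertex a) = vertex (b * a)%g.
Proof. exact: tree_act_point. Qed.

Lemma tree_act1 p : tree_act 1%g p = p.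
Proof.
by have [a [o [u ->]]] := tree_pointP p; rewrite tree_act_point mul1g.
Qed.

Lemma tree_actM b c p : tree_act (b * c)%g p = tree_act b (tree_act c p).
Proof.
by have [a [o [u ->]]] := tree_pointP p; rewrite !tree_act_point mulgA.
Qed.

Lemma tree_actK b p : tree_act (b^-1)%g (tree_act b p) = p.
Proof. by rewrite -tree_actM mulVg tree_act1. Qed.

Lemma tree_act_continuous b : continuous (tree_act b).
Proof.
apply: tree_continuous => a o.
apply: (continuous_eq (fun u => tree_act_point b a o u)).
exact: tree_point_continuous.
Qed.

(** The unit-speed path from the root to [letter_gen l]. An inverse letter runs backwards along the
    edge labelled s that ends at the root. *)
Definition letter_edge (l : S * bool) (u : R) : tree :=
  if l.2 then tree_point (fg_gen l.1)^-1%g (Some l.1) (clamp (1 - u))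
  else tree_point 1%g (Some l.1) (clamp u).

Lemma letter_edge_continuous l : continuous (letter_edge l).
Proof.
rewrite /letter_edge; case: l.2 => /=.
  apply: (@continuous_compose R I tree (fun u : R => clamp (1 - u))
    (tree_point _ _)); last exact: tree_point_continuous.
  apply: continuous_compose; last exact: continuous_clamp.
  by apply: continuous_sub; [exact: continuous_cst|exact: continuous_id].
apply: continuous_compose; first exact: continuous_clamp.
exact: tree_point_continuous.
Qed.

Lemma letter_edge_le0 l u : u <= 0 -> letter_edge l u = vertex 1%g.
Proof.
move=> u0; rewrite /letter_edge; case: l.2.
  by rewrite clamp_ge1 ?tree_point_target ?mulVg //; lra.
by rewrite clamp_le0 // tree_point_source.
Qed.

Lemma letter_edge1 l : letter_edge l 1 = vertex (letter_gen l).
Proof.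
rewrite /letter_edge /letter_gen; case: l.2.
  by rewrite clamp_le0 ?subrr // tree_point_source.
by rewrite clamp_ge1 // tree_point_target mul1g.
Qed.

(* The point at distance u from the root on the path spelled by w. *)
Fixpoint ray (w : seq (S * bool)) (u : R) : tree :=
  if w is l :: w' then
    if u < 1 then letter_edge l u else tree_act (letter_gen l) (ray w' (u - 1))
  else vertex 1%g.

Lemma ray_le0 w u : u <= 0 -> ray w u = vertex 1%g.
Proof.
by case: w => //= l w u0; rewrite letter_edge_le0 // (le_lt_trans u0 ltr01).
Qed.

Lemma ray_continuous w : continuous (ray w).
Proof.
elim: w => [|l w IHw] /=; first exact: continuous_cst.
apply: continuous_if.
- exact: continuous_id.
- exact: continuous_cst.
- exact: letter_edge_continuous.
- apply: continuous_compose (@tree_act_continuous _).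
  apply: (@continuous_compose R R tree (fun u : R => u - 1) (ray w)) IHw.
  by apply: continuous_sub; [exact: continuous_id|exact: continuous_cst].
- by move=> u ->; rewrite letter_edge1 subrr ray_le0 // tree_act_vertex mulg1.
Qed.

Lemma ray1 l u : u <= 1 -> ray [:: l] u = letter_edge l u.
Proof.
rewrite /= le_eqVlt => /predU1P[->|-> //].
by rewrite ltxx letter_edge1 tree_act_vertex mulg1.
Qed.

Lemma ray_prefix w w' u : u <= (size w)%:R -> ray (w ++ w') u = ray w u.
Proof.
elim: w u => [|l w IHw] u /= uw; first by rewrite ray_le0.
by case: ltP => // _; rewrite IHw // lerBlDr natr1.
Qed.

Lemma ray_suffix w w' u :
  0 <= u -> ray (w ++ w') ((size w)%:R + u) = tree_act (word_gen w) (ray w' u).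
Proof.
move=> u0; elim: w => [|l w IHw] /=; first by rewrite add0r tree_act1.
have wu : (size w).+1%:R + u - 1 = (size w)%:R + u by rewrite -natr1; lra.
have w0 : (0 : R) <= (size w)%:R by exact: ler0n.
by rewrite ltNge (_ : 1 <= _) /= ?wu ?IHw ?tree_actM //; lra.
Qed.

(* At time r, a point at distance l from the root lies at distance (1 - r) l on
   the same geodesic; the words involved are reduced. *)
Definition prune_cell (r : I) (a : F) (o : option S) (u : I) : tree :=
  if o is Some s then
    if last (s, false) (word a) == (s, true)
    then ray (word a) ((1 - \val r) * ((size (word a))%:R - \val u))
    else ray (rcons (word a) (s, false))
             ((1 - \val r) * ((size (word a))%:R + \val u))
  else ray (word a) ((1 - \val r) * (size (word a))%:R).

Definition prune (r : I) : tree -> tree := tree_lift (prune_cell r).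

Lemma scale_le (r : I) (n : nat) : (1 - \val r) * n%:R <= (n%:R : R).
Proof.
have := itv_ge0 r; have := itv_le1 r; have : (0 : R) <= n%:R by exact: ler0n.
nra.
Qed.

(** The only real check is at the target of an edge labelled s. By [word_mul_gen], the word of the
    target is either a prefix of that of [a], and then [ray_prefix] identifies the two rays, or that
    word with s appended, and then the rays are the same. *)
Lemma prune_point r a o u : prune r (tree_point a o u) = prune_cell r a o u.
Proof.
apply: tree_liftE => [b [s|] //|b [s|]|//]; last by rewrite mulg1.
  rewrite /=; case: ifP => _; first by rewrite subr0.
  by rewrite addr0 -cats1 ray_prefix // scale_le.
rewrite /prune_cell /option_gen.
have [[w -> ->]|[/negPf -> ->]] := word_mul_gen b s.
  rewrite /= last_rcons eqxx size_rcons -natr1 addrK -cats1.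
  by rewrite ray_prefix // scale_le.
by rewrite size_rcons -natr1.
Qed.

Lemma prune0 p : prune end0 p = p.
Proof.
have [a [o [u ->]]] := tree_pointP p; rewrite prune_point /prune_cell.
have va : ray (word a) (size (word a))%:R = vertex a.
  rewrite -[X in ray X]cats0 -[X in ray _ X]addr0 ray_suffix //=.
  by rewrite tree_act_vertex mulg1 word_genK.
rewrite (_ : \val end0 = 0) // subr0 !mul1r.
case: o => [s|]; last by rewrite tree_point_vertex.
have [[w aw _]|[/negPf -> _]] := word_mul_gen a s.
  (* The edge heads towards the root, so the point lies at distance [1 - u] past the end of [w], on
     the last letter, which is an inverse and is traversed backwards. *)
  rewrite aw last_rcons eqxx size_rcons -natr1 -addrA -cats1.
  rewrite ray_suffix; last by have := itv_le1 u; lra.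
  rewrite ray1; last by have := itv_ge0 u; lra.
  rewrite /letter_edge /= subKr clamp_val tree_act_point.
  by rewrite -[a in RHS]word_genK aw word_gen_rcons.
rewrite -cats1 ray_suffix ?itv_ge0 // ray1 ?itv_le1 // /letter_edge /=.
rewrite clamp_val.
by rewrite tree_act_point mulg1 word_genK.
Qed.

Lemma prune1 p : prune end1 p = vertex 1%g.
Proof.
have [a [o [u ->]]] := tree_pointP p; rewrite prune_point /prune_cell.
rewrite (_ : \val end1 = 1) // subrr !mul0r.
by case: o => [s|]; [case: ifP => _|]; rewrite ray_le0.
Qed.

Lemma prune_root r : prune r (vertex 1%g) = vertex 1%g.
Proof. by rewrite prune_point. Qed.

Lemma prune_continuous : continuous (fun p : tree * I => prune p.2 p.1).
Proof.
apply: tree_prod_continuous => [||a o].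
- exact: compact_interval.
- exact: hausdorff_interval.
apply: (@continuous_eq _ _ _ (fun p : I * I => prune_cell p.2 a o p.1)).
  by move=> p; exact: prune_point.
have cr : continuous (fun p : I * I => 1 - \val p.2).
  apply: continuous_sub; first exact: continuous_cst.
  by apply: continuous_compose; [exact: continuous_snd|exact: continuous_val].
have cu : continuous (fun p : I * I => \val p.1).
  by apply: continuous_compose; [exact: continuous_fst|exact: continuous_val].
have cray w (f : I * I -> R) : continuous f ->
    continuous (fun p : I * I => ray w ((1 - \val p.2) * f p)).
  move=> cf; apply: (continuous_compose (g := ray w));
    last exact: ray_continuous.
  exact: continuous_mul.
case: o => [s|] /=; last by apply: cray; exact: continuous_cst.
case: (last (s, false) (word a) == (s, true)); apply: cray.
- by apply: continuous_sub; first exact: continuous_cst.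
- by apply: continuous_add; first exact: continuous_cst.
Qed.

End Tree.

(** * Splitting off the last entry of a tuple and the last coordinate of a cube *)

Section Snoc.

Definition fsnoc T k (x : {ffun 'I_k -> T}) (y : T) : {ffun 'I_k.+1 -> T} :=
  [ffun j => if unlift ord_max j is Some j' then x j' else y].

Definition finit T k (x : {ffun 'I_k.+1 -> T}) : {ffun 'I_k -> T} :=
  [ffun j => x (lift ord_max j)].

Lemma fsnocK T k (x : {ffun 'I_k.+1 -> T}) : fsnoc (finit x) (x ord_max) = x.
Proof.
by apply/ffunP => j; rewrite ffunE; case: unliftP => [i|] ->; rewrite ?ffunE.
Qed.

Lemma finit_snoc T k (x : {ffun 'I_k -> T}) y : finit (fsnoc x y) = x.
Proof. by apply/ffunP => j; rewrite !ffunE liftK. Qed.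

Lemma fsnoc_last T k (x : {ffun 'I_k -> T}) y : fsnoc x y ord_max = y.
Proof. by rewrite ffunE unlift_none. Qed.

Variable R : realType.
Local Notation I := (unit_interval R).

Definition csnoc k (t : cube R k) (u : I) : cube R k.+1 :=
  fun j => if unlift ord_max j is Some j' then t j' else u.

Definition cinit k (t : cube R k.+1) : cube R k := fun j => t (lift ord_max j).

Definition clast k (t : cube R k.+1) : I := t ord_max.

Lemma csnocK k (t : cube R k.+1) : csnoc (cinit t) (clast t) = t.
Proof. by apply/funext => j; rewrite /csnoc; case: unliftP => [i|] ->. Qed.

Lemma cinit_snoc k (t : cube R k) u : cinit (csnoc t u) = t.
Proof. by apply/funext => j; rewrite /cinit /csnoc liftK. Qed.

Lemma clast_snoc k (t : cube R k) u : clast (csnoc t u) = u.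
Proof. by rewrite /clast /csnoc unlift_none. Qed.

Lemma coface_max e k (t : cube R k) :
  coface e ord_max t = csnoc t (endpoint R e).
Proof. by []. Qed.

(** The index identity by which faces in other directions commute with dropping the last coordinate;
    the later inductions on dimension rest on it. *)
Lemma lift_liftC k (i : 'I_k.+1) (j : 'I_k) :
  lift (lift ord_max i) (lift ord_max j) = lift ord_max (lift i j).
Proof. apply: val_inj; rewrite /= /bump.
by have := ltn_ord i; have := ltn_ord j; lia. Qed.

Lemma lift_max_max k (i : 'I_k.+1) : lift (lift ord_max i) ord_max = ord_max.
Proof.
by apply: val_inj; rewrite /= /bump; have := ltn_ord i; lia.
Qed.

Lemma coface_snoc e k (i : 'I_k.+1) (t : cube R k) u :
  coface e (lift ord_max i) (csnoc t u) = csnoc (coface e i t) u.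
Proof.
apply/funext => j; rewrite /coface /csnoc.
case: (unliftP ord_max j) => [m|] ->; last first.
  have -> : unlift (lift ord_max i) ord_max = Some ord_max.
    by rewrite -[X in unlift _ X](lift_max_max i) liftK.
  by rewrite unlift_none.
case: (unliftP i m) => [m'|] ->; last by rewrite unlift_none.
by rewrite -lift_liftC !liftK.
Qed.

Lemma cube_continuous k (X : topologicalType) (f : X -> cube R k) :
  (forall j, continuous (fun x => f x j)) -> continuous f.
Proof.
by move=> cf x; apply/cvg_sup => j; exact: (continuous_comp_initial (cf j)).
Qed.

Lemma coord_continuous k (j : 'I_k) : continuous (fun t : cube R k => t j).
Proof. exact: proj_continuous. Qed.

Lemma cinit_continuous k : continuous (@cinit k).
Proof. by apply: cube_continuous => j; exact: coord_continuous. Qed.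

Lemma clast_continuous k : continuous (@clast k).
Proof. exact: coord_continuous. Qed.

Lemma csnoc_continuous k : continuous (fun p : cube R k * I => csnoc p.1 p.2).
Proof.
apply: cube_continuous => j; rewrite /csnoc; case: unlift => [i|].
  apply: (@continuous_compose _ _ _ (@fst (cube R k) I)
    (fun t : cube R k => t i)).
    exact: continuous_fst.
  exact: coord_continuous.
exact: continuous_snd.
Qed.

End Snoc.

(** * The action of the free group on tuples and the tree families *)

Section FreeRackSpace.
Variables (R : realType) (S : choiceType).
Local Notation F := (free_group S).
Local Notation X := (free_rack S).
Local Notation B := (rack_space R X).
Local Notation T := (tree R S).
Local Notation I := (unit_interval R).
Local Notation end0 := (endpoint R false).
Local Notation end1 := (endpoint R true).

Definition translate (b : F) (x : X) : X := (x.1, (x.2 * b)%g).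

Definition ftranslate k (b : F) (x : {ffun 'I_k -> X}) : {ffun 'I_k -> X} :=
  [ffun j => translate b (x j)].

(** The group element through which [x] acts on the whole rack. *)
Definition rack_gen (x : X) : F := (x.2^-1 * fg_gen x.1 * x.2)%g.

Lemma rack_op_translate x y : rack_op x y = translate (rack_gen y) x.
Proof. by rewrite /translate /rack_gen !mulgA. Qed.

(** Translating [y] by [b] conjugates [rack_gen y] by [b], so translations are rack
    automorphisms. *)
Lemma translate_op b x y :
  rack_op (translate b x) (translate b y) = translate b (rack_op x y).
Proof.
by rewrite !rack_op_translate /translate /rack_gen /= invgM !mulgA mulgK.
Qed.

Lemma ftranslateM k b c (x : {ffun 'I_k -> X}) :
  ftranslate c (ftranslate b x) = ftranslate (b * c)%g x.
Proof. by apply/ffunP => j; rewrite !ffunE /translate mulgA. Qed.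

Lemma ftranslate1 k (x : {ffun 'I_k -> X}) : ftranslate 1%g x = x.
Proof.
by apply/ffunP => j; rewrite !ffunE /translate mulg1; case: (x j).
Qed.

Lemma ftranslate_snoc k b (x : {ffun 'I_k -> X}) y :
  ftranslate b (fsnoc x y) = fsnoc (ftranslate b x) (translate b y).
Proof.
by apply/ffunP => j; rewrite !ffunE; case: unlift => // i; rewrite ffunE.
Qed.

Lemma finit_translate k b (x : {ffun 'I_k.+1 -> X}) :
  finit (ftranslate b x) = ftranslate b (finit x).
Proof. by apply/ffunP => j; rewrite !ffunE. Qed.

Lemma face_translate e k (i : 'I_k.+1) b x :
  face e i (ftranslate b x) = ftranslate b (face e i x).
Proof.
by apply/ffunP => j; rewrite !ffunE; case: ifP => // _; rewrite translate_op.
Qed.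

Lemma face0_max k (x : {ffun 'I_k.+1 -> X}) : face false ord_max x = finit x.
Proof. by []. Qed.

(** Every other entry precedes the last one and is therefore acted on by it. *)
Lemma face1_max k (x : {ffun 'I_k.+1 -> X}) :
  face true ord_max x = ftranslate (rack_gen (x ord_max)) (finit x).
Proof.
apply/ffunP => j; rewrite !ffunE -rack_op_translate (_ : (_ < _)%N) //.
by rewrite lift_max.
Qed.

Lemma finit_face e k (i : 'I_k.+1) (x : {ffun 'I_k.+2 -> X}) :
  finit (face e (lift ord_max i) x) = face e i (finit x).
Proof.
apply/ffunP => j; rewrite !ffunE lift_liftC.
congr (if _ && _ then _ else _).
by rewrite /= /bump; have := ltn_ord i; have := ltn_ord j; lia.
Qed.

Lemma face_last e k (i : 'I_k.+1) (x : {ffun 'I_k.+2 -> X}) :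
  face e (lift ord_max i) x ord_max = x ord_max.
Proof.
rewrite ffunE lift_max_max (_ : (ord_max < _)%N = false) ?andbF //.
by rewrite /= /bump; have := ltn_ord i; lia.
Qed.

Lemma face_snoc e k (i : 'I_k.+1) (x : {ffun 'I_k.+1 -> X}) y :
  face e (lift ord_max i) (fsnoc x y) = fsnoc (face e i x) y.
Proof.
by rewrite -[LHS]fsnocK finit_face finit_snoc face_last fsnoc_last.
Qed.

Lemma cinit_coface e k (i : 'I_k.+1) (t : cube R k.+1) :
  cinit (coface e (lift ord_max i) t) = coface e i (cinit t).
Proof. by rewrite -{1}[t]csnocK coface_snoc cinit_snoc. Qed.

Lemma clast_coface e k (i : 'I_k.+1) (t : cube R k.+1) :
  clast (coface e (lift ord_max i) t) = clast t.
Proof. by rewrite -{1}[t]csnocK coface_snoc clast_snoc. Qed.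

(** The added entry [(s, 1)] acts as translation by s, so the new coordinate leads from [x]
    translated by [a] to [x] translated by [a s]. *)
Definition tree_family_cell k (x : {ffun 'I_k -> X}) (t : cube R k)
    (a : F) (o : option S) (u : I) : B :=
  if o is Some s
  then rack_point (fsnoc (ftranslate a x) (s, 1%g : F)) (csnoc t u)
  else rack_point (ftranslate a x) t.

Definition tree_family k (x : {ffun 'I_k -> X}) (t : cube R k) : T -> B :=
  tree_lift (tree_family_cell x t).

Lemma tree_family_point k (x : {ffun 'I_k -> X}) t a o u :
  tree_family x t (tree_point a o u) = tree_family_cell x t a o u.
Proof.
apply: tree_liftE => // b [s|] //=; last by rewrite mulg1.
  by rewrite -coface_max -rack_point_face face0_max finit_snoc.
rewrite -coface_max -rack_point_face face1_max finit_snoc fsnoc_last.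
rewrite ftranslateM.
by rewrite /rack_gen /= invg1 mul1g mulg1.
Qed.

Lemma tree_family_vertex k (x : {ffun 'I_k -> X}) t a :
  tree_family x t (vertex R a) = rack_point (ftranslate a x) t.
Proof. exact: tree_family_point. Qed.

(** Only the product of [b] with the vertex enters the cell, so translating the tuple on the right
    is the same as acting on the tree on the left. *)
Lemma tree_family_translate k (x : {ffun 'I_k -> X}) t b p :
  tree_family (ftranslate b x) t p = tree_family x t (tree_act b p).
Proof.
have [a [o [u ->]]] := tree_pointP p.
rewrite tree_act_point !tree_family_point /tree_family_cell.
by case: o => [s|]; rewrite ftranslateM.
Qed.

Lemma tree_family_face e k (i : 'I_k.+1) (x : {ffun 'I_k.+1 -> X}) t p :
  tree_family (face e i x) t p = tree_family x (coface e i t) p.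
Proof.
have [a [o [u ->]]] := tree_pointP p.
rewrite !tree_family_point /tree_family_cell -face_translate.
case: o => [s|]; last exact: rack_point_face.
by rewrite -face_snoc rack_point_face coface_snoc.
Qed.

Lemma tree_family_continuous k (x : {ffun 'I_k -> X}) :
  continuous (fun p : T * cube R k => tree_family x p.2 p.1).
Proof.
apply: tree_prod_continuous => [||a o].
- exact: compact_cube.
- exact: hausdorff_cube.
apply: (@continuous_eq _ _ _
  (fun p : I * cube R k => tree_family_cell x p.2 a o p.1)).
  by move=> p; exact: tree_family_point.
case: o => [s|] /=; last first.
  apply: (@continuous_compose _ _ _ (@snd I (cube R k)) (rack_point _)).
    exact: continuous_snd.
  exact: rack_point_continuous.
apply: (@continuous_compose _ _ _ (fun p : I * cube R k => csnoc p.2 p.1)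
  (rack_point _)).
  apply: (@continuous_compose _ _ _ (fun p : I * cube R k => (p.2, p.1))
    (fun p => csnoc p.1 p.2)).
    by apply: continuous_pair; [exact: continuous_snd|exact: continuous_fst].
  exact: csnoc_continuous.
exact: rack_point_continuous.
Qed.

End FreeRackSpace.

(** * Time profile of a single push *)

Section Profile.
Variable R : realType.
Local Notation I := (unit_interval R).

(** A trapezoid of height 1 over the thirds of the interval. On the outer thirds it is the parameter
    to which [slide] contracts the tree; on the middle third the contraction is complete. *)
Definition delay (t : I) : R :=
  Num.min 1 (Num.min (3 * \val t) (3 * (1 - \val t))).

(** Collapses each outer third to an endpoint and expands the middle third onto the whole
    interval. *)
Definition stretch (t : I) : I := clamp (3 * \val t - 1).

(* Moves t towards [stretch t] at unit speed, arriving no later than [delay t]. *)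
Definition toward_stretch (v : R) (t : I) : I :=
  clamp (Num.max (\val t - v) (Num.min (\val t + v) (\val (stretch t)))).

Lemma delay_ge0 t : 0 <= delay t.
Proof.
have := itv_ge0 t; have := itv_le1 t => t1 t0.
by rewrite /delay !le_min ler01 !mulr_ge0 //; lra.
Qed.

Lemma delay_endpoint e : delay (endpoint R e) = 0.
Proof.
rewrite /delay /=; case: e => /=.
  by rewrite subrr mulr0 (@min_r _ _ (3 * 1)) ?min_r //; lra.
by rewrite mulr0 (@min_l _ _ 0) ?min_r //; lra.
Qed.

Lemma delayE t : delay t =
  if 3 * \val t < 1 then 3 * \val t else
  if 3 * \val t < 2 then 1 else 3 * (1 - \val t).
Proof.
have := itv_ge0 t; have := itv_le1 t; rewrite /delay !/Num.min.
by repeat case: ifP => //; try lra.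
Qed.

Lemma stretchE t : \val (stretch t) =
  if 3 * \val t < 1 then 0 else if 3 * \val t < 2 then 3 * \val t - 1 else 1.
Proof.
have := itv_ge0 t; have := itv_le1 t; rewrite /= /Num.max /Num.min.
by repeat case: ifP => //; try lra.
Qed.

Lemma toward_stretch0 t : toward_stretch 0 t = t.
Proof.
rewrite /toward_stretch subr0 addr0 -[RHS]clamp_val; congr clamp.
by apply/max_idPl; rewrite ge_min lexx.
Qed.

(** The distance from t to [stretch t] never exceeds the delay: it is t against 3t on the first
    third, at most 1/3 against 1 on the middle one, and symmetrically on the last. *)
Lemma toward_stretch_delay t : toward_stretch (delay t) t = stretch t.
Proof.
rewrite /toward_stretch -[RHS]clamp_val; congr clamp.
rewrite delayE stretchE; have := itv_ge0 t; have := itv_le1 t.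
rewrite /Num.max /Num.min.
by repeat case: ifP => //; try lra.
Qed.

Lemma continuous_delay : continuous delay.
Proof.
apply: continuous_minr; first exact: continuous_cst.
apply: continuous_minr; apply: continuous_mul; try exact: continuous_cst.
  exact: continuous_val.
by apply: continuous_sub; [exact: continuous_cst|exact: continuous_val].
Qed.

Lemma continuous_stretch : continuous stretch.
Proof.
apply: (continuous_compose (g := @clamp R)); last exact: continuous_clamp.
apply: continuous_sub; last exact: continuous_cst.
by apply: continuous_mul; [exact: continuous_cst|exact: continuous_val].
Qed.

Lemma continuous_toward_stretch :
  continuous (fun p : I * R => toward_stretch p.2 p.1).
Proof.
have ct : continuous (fun p : I * R => \val p.1).
  by apply: continuous_compose; [exact: continuous_fst|exact: continuous_val].
apply: (continuous_compose (g := @clamp R)); last exact: continuous_clamp.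
apply: continuous_maxr.
  by apply: continuous_sub; [|exact: continuous_snd].
apply: continuous_minr.
  by apply: continuous_add; [|exact: continuous_snd].
apply: (@continuous_compose _ _ _ (fun p : I * R => stretch p.1));
  last exact: continuous_val.
exact: (continuous_compose (@continuous_fst I R) continuous_stretch).
Qed.

End Profile.

(** * Removing the cube coordinates one by one *)

Section Deformation.
Variables (R : realType) (S : choiceType).
Local Notation F := (free_group S).
Local Notation X := (free_rack S).
Local Notation B := (rack_space R X).
Local Notation T := (tree R S).
Local Notation I := (unit_interval R).
Local Notation end0 := (endpoint R false).
Local Notation end1 := (endpoint R true).

(** The contraction recentred at the vertex of the inverse of [w]: translating an entry [(s, w)] by
    that inverse gives [(s, 1)]. *)
Definition prune_from (w : F) (r : I) (p : T) : T :=
  tree_act w^-1%g (prune r (tree_act w p)).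

Lemma prune_from0 w p : prune_from w end0 p = p.
Proof. by rewrite /prune_from prune0 tree_actK. Qed.

Lemma prune_from1 w p : prune_from w end1 p = vertex R w^-1%g.
Proof. by rewrite /prune_from prune1 tree_act_vertex mulg1. Qed.

Lemma prune_from_act w b r p :
  tree_act b (prune_from (w * b)%g r p) = prune_from w r (tree_act b p).
Proof. by rewrite /prune_from -!tree_actM invgM mulgA mulgV mul1g. Qed.

Lemma continuous_prune_from w :
  continuous (fun p : T * I => prune_from w p.2 p.1).
Proof.
apply: (continuous_compose (g := tree_act w^-1%g));
  last exact: tree_act_continuous.
apply: (@continuous_compose _ _ _ (fun p : T * I => (tree_act w p.1, p.2))
          (fun p : T * I => prune p.2 p.1)); last exact: prune_continuous.
apply: continuous_pair; last exact: continuous_snd.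
exact: (continuous_compose (@continuous_fst T I) (@tree_act_continuous _ _ _)).
Qed.

(* The retraction of [I x T], with values in the tree family of the tuple from
   which the last entry x has been dropped. *)
Definition slide (x : X) (t : I) (p : T) : T :=
  if 3 * \val t < 1 then prune_from x.2 (clamp (3 * \val t)) p else
  if 3 * \val t < 2
  then tree_point x.2^-1%g (Some x.1) (clamp (3 * \val t - 1))
  else tree_act (rack_gen x) (prune_from x.2 (clamp (3 * (1 - \val t))) p).

Lemma slide0 x p : slide x end0 p = p.
Proof.
by rewrite /slide /= mulr0 ltr01 clamp_le0 // prune_from0.
Qed.

Lemma slide1 x p : slide x end1 p = tree_act (rack_gen x) p.
Proof.
rewrite /slide (_ : \val end1 = 1) // mulr1 !ifN; [|rewrite -leNgt; lra..].
by rewrite subrr mulr0 clamp_le0 // prune_from0.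
Qed.

(** The centre of the contraction moves with [b] and [rack_gen x] gets conjugated. This equivariance
    absorbs the translation on a face with [e = true]. *)
Lemma slide_translate b x t p :
  tree_act b (slide (translate b x) t p) = slide x t (tree_act b p).
Proof.
rewrite /slide /=; case: ifP => _; first exact: prune_from_act.
case: ifP => _; first by rewrite tree_act_point invgM mulgA mulgV mul1g.
rewrite -prune_from_act -!tree_actM; congr (tree_act _ _).
by rewrite /rack_gen /= invgM !mulgA mulgV mul1g.
Qed.

Lemma slide_continuous x : continuous (fun p : T * I => slide x p.2 p.1).
Proof.
have ct : continuous (fun p : T * I => 3 * \val p.2).
  apply: continuous_mul; first exact: continuous_cst.
  by apply: continuous_compose; [exact: continuous_snd|exact: continuous_val].
have ct' : continuous (fun p : T * I => 3 * (1 - \val p.2)).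
  apply: continuous_mul; first exact: continuous_cst.
  apply: continuous_sub; first exact: continuous_cst.
  by apply: continuous_compose; [exact: continuous_snd|exact: continuous_val].
have cc (f : T * I -> R) : continuous f ->
    continuous (fun p : T * I => prune_from x.2 (clamp (f p)) p.1).
  move=> cf; apply: (@continuous_compose _ _ _
    (fun p : T * I => (p.1, clamp (f p)))
    (fun p : T * I => prune_from x.2 p.2 p.1));
      last exact: continuous_prune_from.
  apply: continuous_pair; first exact: continuous_fst.
  by apply: (continuous_compose (g := @clamp R)) => //; exact: continuous_clamp.
apply: continuous_if => //; first exact: continuous_cst.
- exact: cc.
- apply: continuous_if => //; first exact: continuous_cst.
  + apply: (@continuous_compose _ _ _
      (fun p : T * I => clamp (3 * \val p.2 - 1))
      (tree_point x.2^-1%g (Some x.1))); last exact: tree_point_continuous.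
    apply: (continuous_compose (g := @clamp R)); last exact: continuous_clamp.
    by apply: continuous_sub => //; exact: continuous_cst.
  + apply: (continuous_compose (g := tree_act _)); first exact: cc.
    exact: tree_act_continuous.
  (* At 3t = 2 the edge ends at the vertex w^-1 s, which is also the image of the centre w^-1 under
     [rack_gen x]. *)
  + move=> [p t] /= t2; rewrite !clamp_ge1; [|lra|lra].
    rewrite prune_from1 tree_point_target tree_act_vertex /rack_gen.
    by rewrite mulgK.
- move=> [p t] /= t1; rewrite t1 ltr1n clamp_ge1 // clamp_le0 ?subrr //.
  by rewrite prune_from1 tree_point_source.
Qed.

Fixpoint slide_all k : {ffun 'I_k -> X} -> cube R k -> T -> T :=
  if k is k'.+1 then fun x t p =>
    slide_all (finit x) (cinit t) (slide (x ord_max) (clast t) p)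
  else fun _ _ p => p.

Fixpoint total_delay k : cube R k -> R :=
  if k is k'.+1 then fun t => delay (clast t) + total_delay (cinit t)
  else fun=> 0.

(* [deform] performs the pushes one after the other; the last coordinate is
   removed at time [delay (clast t)]. *)
Fixpoint deform k : {ffun 'I_k -> X} -> cube R k -> T -> R -> B :=
  if k is k'.+1 then fun x t p v =>
    if v < delay (clast t) then
      tree_family x (csnoc (cinit t) (toward_stretch v (clast t)))
        (prune_from (x ord_max).2 (clamp v) p)
    else deform (finit x) (cinit t) (slide (x ord_max) (clast t) p)
           (v - delay (clast t))
  else fun x t p _ => tree_family x t p.

(** The end of a push already lies in the family of the shorter tuple. On the outer thirds [stretch]
    reaches a face of the cube; on the middle third the tree has shrunk to a vertex, which sweeps
    out an edge of that family. *)
Lemma tree_family_slide k (x : {ffun 'I_k.+1 -> X}) t p :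
  tree_family x (csnoc (cinit t) (stretch (clast t)))
    (prune_from (x ord_max).2 (clamp (delay (clast t))) p) =
  tree_family (finit x) (cinit t) (slide (x ord_max) (clast t) p).
Proof.
move: (cinit t) (clast t) => {}t u; rewrite /slide.
have := stretchE u; rewrite delayE; case: ifP => _ => [su|].
  rewrite (_ : stretch u = end0); last exact: val_inj.
  by rewrite -coface_max -tree_family_face face0_max.
case: ifP => [u2 su|_ su].
  rewrite clamp_ge1 // prune_from1 tree_family_vertex tree_family_point /=.
  (* After translation to the centre the last entry is [(s, 1)], exactly the entry that an edge
     labelled s adds to the shorter tuple. *)
  rewrite -[X in ftranslate _ X]fsnocK ftranslate_snoc /translate mulgV.
  by rewrite -su clamp_val.
rewrite (_ : stretch u = end1); last exact: val_inj.
by rewrite -coface_max -tree_family_face face1_max tree_family_translate.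
Qed.

Lemma deform0 k (x : {ffun 'I_k -> X}) t p : deform x t p 0 = tree_family x t p.
Proof.
elim: k x t p => //= k IHk x t p; case: ltP => [_|d0].
  by rewrite toward_stretch0 clamp_le0 // prune_from0 csnocK.
have d : delay (clast t) = 0 by apply/eqP; rewrite eq_le d0 delay_ge0.
(* With zero delay the first push is skipped, but it moves nothing: its start and its end
   coincide. *)
rewrite d subr0 IHk -tree_family_slide -toward_stretch_delay d.
by rewrite toward_stretch0 clamp_le0 // prune_from0 csnocK.
Qed.

Lemma total_delay_ge0 k (t : cube R k) : 0 <= total_delay t.
Proof. by elim: k t => //= k IHk t; rewrite addr_ge0 // delay_ge0. Qed.

(** The empty tuple and the point of the 0-cube are arbitrary parameters, which avoids naming those
    left by the recursion. *)
Lemma deform_total k (x : {ffun 'I_k -> X}) t p x0 t0 :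
  deform x t p (total_delay t) = @tree_family R S 0 x0 t0 (slide_all x t p).
Proof.
elim: k x t p => [|k IHk] x t p /=.
  have -> : x0 = x by apply/ffunP => -[].
  by have -> : t0 = t by apply/funext => -[].
by rewrite ltNge lerDl total_delay_ge0 /= addrC addKr.
Qed.

Lemma slide_all_translate k b (x : {ffun 'I_k -> X}) t p :
  tree_act b (slide_all (ftranslate b x) t p) = slide_all x t (tree_act b p).
Proof.
elim: k x t p => //= k IHk x t p.
by rewrite finit_translate IHk ffunE slide_translate.
Qed.

Lemma deform_translate k b (x : {ffun 'I_k -> X}) t p v :
  deform (ftranslate b x) t p v = deform x t (tree_act b p) v.
Proof.
elim: k x t p v => [|k IHk] x t p v /=; first exact: tree_family_translate.
rewrite finit_translate IHk tree_family_translate ffunE.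
by rewrite prune_from_act slide_translate.
Qed.

Lemma slide_allS k (x : {ffun 'I_k.+1 -> X}) t p :
  slide_all x t p =
  slide_all (finit x) (cinit t) (slide (x ord_max) (clast t) p).
Proof. by []. Qed.

Lemma slide_all_face_max e k (x : {ffun 'I_k.+1 -> X}) t p :
  exists b, slide_all x (coface e ord_max t) p =
            tree_act b (slide_all (face e ord_max x) t p).
Proof.
rewrite coface_max /= clast_snoc cinit_snoc; case: e.
  exists (rack_gen (x ord_max)).
  by rewrite slide1 face1_max slide_all_translate.
by exists 1%g; rewrite slide0 face0_max tree_act1.
Qed.

(** In the last direction, a face with [e = true] translates the shorter tuple, so invariance holds
    only up to the group: [slide_all] descends to a map into the orbit space of the tree. Other
    directions reduce to the shorter tuple by induction. *)
Lemma slide_all_face e k (i : 'I_k.+1) (x : {ffun 'I_k.+1 -> X}) t p :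
  exists b,
    slide_all x (coface e i t) p = tree_act b (slide_all (face e i x) t p).
Proof.
elim: k i x t p => [|k IHk] i x t p; case: (unliftP ord_max i) => [j|] -> {i}.
- by case: j.
- exact: slide_all_face_max.
- rewrite slide_allS (slide_allS (face _ _ _)) cinit_coface clast_coface.
  by rewrite finit_face face_last; exact: IHk.
- exact: slide_all_face_max.
Qed.

Lemma total_delayS k (t : cube R k.+1) :
  total_delay t = delay (clast t) + total_delay (cinit t).
Proof. by []. Qed.

Lemma total_delay_face_max e k (t : cube R k) :
  total_delay (coface e ord_max t) = total_delay t.
Proof. by rewrite coface_max /= clast_snoc cinit_snoc delay_endpoint add0r. Qed.

Lemma total_delay_face e k (i : 'I_k.+1) (t : cube R k) :
  total_delay (coface e i t) = total_delay t.
Proof.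
elim: k i t => [|k IHk] i t; case: (unliftP ord_max i) => [j|] -> {i}.
- by case: j.
- exact: total_delay_face_max.
- by rewrite total_delayS cinit_coface clast_coface IHk.
- exact: total_delay_face_max.
Qed.

Lemma deformS k (x : {ffun 'I_k.+1 -> X}) t p v :
  deform x t p v =
    if v < delay (clast t) then
      tree_family x (csnoc (cinit t) (toward_stretch v (clast t)))
        (prune_from (x ord_max).2 (clamp v) p)
    else deform (finit x) (cinit t) (slide (x ord_max) (clast t) p)
           (v - delay (clast t)).
Proof. by []. Qed.

Lemma deform_face_max e k (x : {ffun 'I_k.+1 -> X}) t p v : 0 <= v ->
  deform x (coface e ord_max t) p v = deform (face e ord_max x) t p v.
Proof.
move=> v0; rewrite coface_max /= clast_snoc cinit_snoc delay_endpoint ltNge v0.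
rewrite subr0 /=; case: e; last by rewrite slide0 face0_max.
by rewrite slide1 face1_max deform_translate.
Qed.

(** Here no group element remains, since [tree_family] absorbs translations. A coordinate at an
    endpoint has delay 0, so for nonnegative [v] its push is skipped at once. *)
Lemma deform_face e k (i : 'I_k.+1) (x : {ffun 'I_k.+1 -> X}) t p v : 0 <= v ->
  deform x (coface e i t) p v = deform (face e i x) t p v.
Proof.
elim: k i x t p v => [|k IHk] i x t p v v0;
  case: (unliftP ord_max i) => [j|] -> {i}.
- by case: j.
- exact: deform_face_max.
- rewrite deformS [in RHS]deformS cinit_coface clast_coface.
  rewrite finit_face face_last -coface_snoc tree_family_face.
  by case: ltP => // dv; rewrite IHk // subr_ge0.
- exact: deform_face_max.
Qed.

Lemma slide_step_continuous k x :
  continuous (fun p : T * cube R k.+1 => (slide x (clast p.2) p.1, cinit p.2)).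
Proof.
apply: continuous_pair.
  apply: (@continuous_compose _ _ _
    (fun p : T * cube R k.+1 => (p.1, clast p.2))
    (fun p : T * I => slide x p.2 p.1)); last exact: slide_continuous.
  apply: continuous_pair; first exact: continuous_fst.
  by apply: continuous_compose; [exact: continuous_snd|exact: clast_continuous].
by apply: continuous_compose; [exact: continuous_snd|exact: cinit_continuous].
Qed.

Lemma slide_all_continuous k (x : {ffun 'I_k -> X}) :
  continuous (fun p : T * cube R k => slide_all x p.2 p.1).
Proof.
elim: k x => [|k IHk] x /=; first exact: continuous_fst.
exact: (continuous_compose (@slide_step_continuous k (x ord_max))
  (IHk (finit x))).
Qed.

Lemma total_delay_continuous k : continuous (@total_delay k).
Proof.
elim: k => [|k IHk] /=; first exact: continuous_cst.
apply: continuous_add.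
  exact: (continuous_compose (@clast_continuous R k) (@continuous_delay R)).
exact: (continuous_compose (@cinit_continuous R k) IHk).
Qed.

Lemma deform_continuous k (x : {ffun 'I_k -> X}) :
  continuous (fun p : (T * cube R k) * R => deform x p.1.2 p.1.1 p.2).
Proof.
elim: k x => [|k IHk] x /=.
  apply: (@continuous_compose _ _ _ (@fst (T * cube R 0) R)
    (fun p : T * cube R 0 => tree_family x p.2 p.1)).
    exact: continuous_fst.
  exact: tree_family_continuous.
have c1 : continuous (fun p : (T * cube R k.+1) * R => p.1).
  exact: continuous_fst.
have cv : continuous (fun p : (T * cube R k.+1) * R => p.2).
  exact: continuous_snd.
have cp : continuous (fun p : (T * cube R k.+1) * R => p.1.1).
  exact: (continuous_compose c1 (@continuous_fst T (cube R k.+1))).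
have ct : continuous (fun p : (T * cube R k.+1) * R => p.1.2).
  exact: (continuous_compose c1 (@continuous_snd T (cube R k.+1))).
have cl : continuous (fun p : (T * cube R k.+1) * R => clast p.1.2).
  exact: (continuous_compose ct (@clast_continuous R k)).
have cd : continuous (fun p : (T * cube R k.+1) * R => delay (clast p.1.2)).
  exact: (continuous_compose cl (@continuous_delay R)).
apply: continuous_if => //.
- apply: (@continuous_compose _ _ _ (fun p : (T * cube R k.+1) * R =>
      (prune_from (x ord_max).2 (clamp p.2) p.1.1,
       csnoc (cinit p.1.2) (toward_stretch p.2 (clast p.1.2))))
    (fun p : T * cube R k.+1 => tree_family x p.2 p.1));
      last exact: tree_family_continuous.
  apply: continuous_pair.
    apply: (@continuous_compose _ _ _
      (fun p : (T * cube R k.+1) * R => (p.1.1, clamp p.2))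
      (fun p : T * I => prune_from (x ord_max).2 p.2 p.1));
      last exact: continuous_prune_from.
    apply: continuous_pair => //.
    exact: (continuous_compose cv (@continuous_clamp R)).
  apply: (@continuous_compose _ _ _ (fun p : (T * cube R k.+1) * R =>
      (cinit p.1.2, toward_stretch p.2 (clast p.1.2)))
    (fun p : cube R k * I => csnoc p.1 p.2)); last exact: csnoc_continuous.
  apply: continuous_pair.
    exact: (continuous_compose ct (@cinit_continuous R k)).
  apply: (@continuous_compose _ _ _
    (fun p : (T * cube R k.+1) * R => (clast p.1.2, p.2))
    (fun p : I * R => toward_stretch p.2 p.1));
      last exact: continuous_toward_stretch.
  exact: continuous_pair.
- apply: (@continuous_compose _ _ _ (fun p : (T * cube R k.+1) * R =>
      ((slide (x ord_max) (clast p.1.2) p.1.1, cinit p.1.2),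
       p.2 - delay (clast p.1.2)))
    (fun p : (T * cube R k) * R => deform (finit x) p.1.2 p.1.1 p.2));
      last exact: IHk.
  apply: continuous_pair; last exact: continuous_sub.
  exact: (continuous_compose c1 (@slide_step_continuous k (x ord_max))).
(* At the switching time the finished push meets the start of the next one. *)
- move=> [[p t] v] /= ->; rewrite subrr deform0 -tree_family_slide.
  by rewrite toward_stretch_delay.
Qed.

End Deformation.

(** * Homotopy equivalence with a model of the orbit space of the tree *)

Section GeneralTarget.
Variables (R : realType) (S : choiceType).
Local Notation F := (free_group S).
Local Notation X := (free_rack S).
Local Notation B := (rack_space R X).
Local Notation T := (tree R S).
Local Notation I := (unit_interval R).

Definition fempty : {ffun 'I_0 -> X} := ffun0 (card_ord 0).

Definition cempty : cube R 0 := fun=> endpoint R false.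

Lemma ffun_empty (x : {ffun 'I_0 -> X}) : x = fempty.
Proof. by apply/ffunP => -[]. Qed.

Variables (W : topologicalType) (pr : T -> W) (g : W -> B).
Hypotheses (cpr : continuous pr) (cg : continuous g).
Hypothesis pr_act : forall b p, pr (tree_act b p) = pr p.
Hypothesis gprE : forall p, g (pr p) = tree_family fempty cempty p.

(** [W] models the orbit space of the tree, with [pr] the projection and [g] induced by the family
    of the empty tuple. A point of the rack space is pushed from the root of its own tree family;
    invariance of [pr] removes the ambiguity of [slide_all_face]. *)
Definition collapse : B -> W :=
  rack_lift (fun k x t => pr (slide_all x t (vertex R 1%g))).

Lemma collapseE k (x : {ffun 'I_k -> X}) t :
  collapse (rack_point x t) = pr (slide_all x t (vertex R 1%g)).
Proof.
apply: rack_liftE => e m i y s.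
by have [b ->] := slide_all_face e i y s (vertex R 1%g); rewrite pr_act.
Qed.

Lemma continuous_collapse : continuous collapse.
Proof.
apply: rack_space_continuous => k x.
apply: (continuous_eq (fun t => collapseE x t)).
apply: (@continuous_compose _ _ _
  (fun t : cube R k => slide_all x t (vertex R 1%g)) pr) => //.
apply: (@continuous_compose _ _ _ (fun t : cube R k => (vertex R 1%g : T, t))
  (fun p : T * cube R k => slide_all x p.2 p.1));
    last exact: slide_all_continuous.
by apply: continuous_pair; [exact: continuous_cst|exact: continuous_id].
Qed.

(** Time is reversed and rescaled: all pushes are completed at 0, and none has begun at 1. *)
Definition collapse_homotopy (p : B * I) : B :=
  rack_lift (fun k x t =>
    deform x t (vertex R 1%g) ((1 - \val p.2) * total_delay t)) p.1.

Lemma collapse_homotopyE k (x : {ffun 'I_k -> X}) t u :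
  collapse_homotopy (rack_point x t, u) =
  deform x t (vertex R 1%g) ((1 - \val u) * total_delay t).
Proof.
apply: rack_liftE => e m i y s; rewrite total_delay_face deform_face //.
by rewrite mulr_ge0 ?total_delay_ge0 // subr_ge0 itv_le1.
Qed.

Lemma continuous_collapse_homotopy : continuous collapse_homotopy.
Proof.
apply: rack_space_prod_continuous => [||k x].
- exact: compact_interval.
- exact: hausdorff_interval.
apply: (@continuous_eq _ _ _ (fun p : cube R k * I =>
  deform x p.1 (vertex R 1%g) ((1 - \val p.2) * total_delay p.1))).
  by move=> p; exact: collapse_homotopyE.
apply: (@continuous_compose _ _ _ (fun p : cube R k * I =>
    (vertex R 1%g : T, p.1, (1 - \val p.2) * total_delay p.1))
  (fun p : (T * cube R k) * R => deform x p.1.2 p.1.1 p.2));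
    last exact: deform_continuous.
apply: continuous_pair.
  by apply: continuous_pair; [exact: continuous_cst|exact: continuous_fst].
apply: continuous_mul.
  apply: continuous_sub; first exact: continuous_cst.
  by apply: continuous_compose; [exact: continuous_snd|exact: continuous_val].
exact: (continuous_compose (@continuous_fst (cube R k) I)
  (@total_delay_continuous R k)).
Qed.

Lemma homotopic_collapse : homotopic R (g \o collapse) idfun.
Proof.
exists collapse_homotopy; split; first exact: continuous_collapse_homotopy.
- move=> b; have [k [x [t ->]]] := rack_pointP b.
  rewrite collapse_homotopyE (_ : \val _ = 0) // subr0 mul1r /= collapseE gprE.
  exact: deform_total.
- move=> b; have [k [x [t ->]]] := rack_pointP b.
  rewrite collapse_homotopyE (_ : \val _ = 1) // subrr mul0r deform0.
  by rewrite tree_family_vertex ftranslate1.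
Qed.

Lemma homotopy_equivalent_collapse :
  homotopic R (collapse \o g) idfun -> homotopy_equivalent R B W.
Proof.
move=> fg; exists collapse, g; split=> //.
  exact: continuous_collapse.
exact: homotopic_collapse.
Qed.

End GeneralTarget.

(** * Parametrizing the circle by the interval *)

Section CircleParameter.
Variable R : realType.
Local Notation I := (unit_interval R).

(* Parametrizes by the first coordinate, affine in u on each half-circle. *)
Definition circle_param (u : R) : R * R :=
  if u < 2^-1 then (1 - 4 * u, Num.sqrt (1 - (1 - 4 * u) ^+ 2))
  else (4 * u - 3, - Num.sqrt (1 - (4 * u - 3) ^+ 2)).

Lemma circle_param_subproof (u : I) : circle_param (\val u) \in circle R.
Proof.
move: (itv_ge0 u) (itv_le1 u); move: (\val u) => v v0 v1.
have sq (a : R) : 0 <= a <= 2 -> 0 <= 1 - (1 - a) ^+ 2.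
  move=> /andP[a0 a2]; rewrite (_ : _ - _ = a * (2 - a)); last by ring.
  by rewrite mulr_ge0 // subr_ge0.
rewrite inE /circle /circle_param /=; case: ltP => v2 /=.
  by rewrite sqr_sqrtr; [ring|apply: sq; lra].
rewrite sqrrN sqr_sqrtr; first by ring.
by rewrite (_ : 4 * v - 3 = 1 - (4 - 4 * v)); [apply: sq; lra|ring].
Qed.

Definition loop (u : I) : circle R :=
  exist _ (circle_param (\val u)) (circle_param_subproof u).

Lemma loop_endpoint e : loop (endpoint R e) = circle_base R.
Proof.
apply: val_inj; rewrite /= /circle_param; case: e => /=.
  rewrite ifN; last by rewrite -leNgt; lra.
  rewrite (_ : 4 * 1 - 3 = 1); last by lra.
  by rewrite expr1n subrr sqrtr0 oppr0.
by rewrite ifT ?mulr0 ?subr0 ?expr1n ?subrr ?sqrtr0 //; lra.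
Qed.

Lemma continuous_loop : continuous loop.
Proof.
apply: continuous_comp_initial.
apply: (@continuous_compose _ _ _ (\val : I -> R) circle_param);
  first exact: continuous_val.
have cl (c d : R) : continuous (fun u : R => c + d * u).
  apply: continuous_add; first exact: continuous_cst.
  by apply: continuous_mul; [exact: continuous_cst|exact: continuous_id].
have cs (f : R -> R) :
    continuous f -> continuous (fun u => Num.sqrt (1 - f u ^+ 2)).
  move=> cf; apply: (continuous_compose (g := @Num.sqrt R));
    last exact: sqrt_continuous.
  apply: continuous_sub; first exact: continuous_cst.
  exact: continuous_mul.
have c1 : continuous (fun u : R => 1 - 4 * u).
  by apply: continuous_eq (cl 1 (-4)) => u; rewrite mulNr.
have c2 : continuous (fun u : R => 4 * u - 3).
  by apply: continuous_eq (cl (-3) 4) => u; rewrite addrC.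
apply: continuous_if.
- exact: continuous_id.
- exact: continuous_cst.
- by apply: continuous_pair => //; exact: cs.
- apply: continuous_pair => //.
  apply: (@continuous_eq _ _ _
    (fun u : R => 0 - Num.sqrt (1 - (4 * u - 3) ^+ 2))).
    by move=> u; rewrite sub0r.
  by apply: continuous_sub; [exact: continuous_cst|exact: cs].
- move=> u ->; rewrite (_ : 1 - 4 * 2^-1 = -1); last by lra.
  rewrite (_ : 4 * 2^-1 - 3 = -1); last by lra.
  by rewrite sqrrN expr1n subrr sqrtr0 oppr0.
Qed.

(** Solves the two formulas of [circle_param] for u. The base point gets 0, while points approaching
    it from below have parameters tending to 1, so the angle is discontinuous there. *)
Definition plane_angle (p : R * R) : I :=
  if p.2 < 0 then clamp ((3 + p.1) / 4) else clamp ((1 - p.1) / 4).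

Definition circle_angle (p : circle R) : I := plane_angle (\val p).

Lemma circle_angleK : cancel circle_angle loop.
Proof.
move=> [[x y] xy]; apply: val_inj; rewrite /= /circle_angle /plane_angle /=.
have {xy} xy : x ^+ 2 + y ^+ 2 = 1 by move: xy; rewrite inE.
have [x1 x2] : -1 <= x /\ x <= 1 by split; nra.
have y2 : 1 - x ^+ 2 = y ^+ 2 by lra.
case: ltP => y0; (rewrite clampE; last by lra); rewrite /circle_param.
  rewrite ifN; last by rewrite -leNgt; lra.
  rewrite (_ : 4 * _ - 3 = x); last by field.
  by rewrite y2 sqrtr_sqr ltr0_norm // opprK.
case: ltP => x3.
  rewrite (_ : 1 - 4 * _ = x); last by field.
  by rewrite y2 sqrtr_sqr ger0_norm.
(* The parameter is at least 1/2, which on the closed upper half forces the leftmost point;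
   [circle_param] uses its lower formula there. *)
have x' : x = -1 by lra.
have y' : y = 0 by apply/eqP; rewrite -sqrf_eq0 -y2 x'; apply/eqP; ring.
rewrite x' y' (_ : 4 * _ - 3 = -1); last by field.
by rewrite sqrrN expr1n subrr sqrtr0 oppr0.
Qed.

Lemma plane_angle_param (v : R) :
  0 <= v < 1 -> plane_angle (circle_param v) = clamp v.
Proof.
move=> /andP[v0 v1]; rewrite /plane_angle.
rewrite /circle_param; case: (ltP v) => v2 /=.
  by rewrite ltNge sqrtr_ge0 /=; congr clamp; field.
case: ltP => [_|]; first by congr clamp; field.
(* A nonnegative second coordinate on the lower half forces the square root to vanish, hence v =
   1/2, where both formulas for the angle agree. *)
rewrite oppr_ge0 => s0; have s1 : 1 - (4 * v - 3) ^+ 2 <= 0.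
  by rewrite leNgt -sqrtr_gt0 -leNgt.
have : (v - 2^-1) * (1 - v) <= 0.
  by rewrite (_ : _ * _ = (1 - (4 * v - 3) ^+ 2) / 16); [lra|field].
rewrite pmulr_lle0 ?subr_gt0 // subr_le0 => v3.
by congr clamp; lra.
Qed.

Lemma loopK (u : I) : \val u < 1 -> circle_angle (loop u) = u.
Proof.
move=> u1; rewrite -[RHS]clamp_val; apply: plane_angle_param.
by rewrite itv_ge0.
Qed.

Lemma circle_angle_base : circle_angle (circle_base R) = endpoint R false.
Proof.
by rewrite /circle_angle /plane_angle /= ltxx clamp_le0 // subrr mul0r.
Qed.

Lemma angle_loop Y (f : I -> Y) u :
  f (endpoint R false) = f (endpoint R true) -> f (circle_angle (loop u)) = f u.
Proof.
move=> f01; have [u1|u1] := ltP (\val u) 1; first by rewrite loopK.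
have -> : u = endpoint R true by rewrite -[LHS]clamp_val clamp_ge1.
by rewrite loop_endpoint circle_angle_base.
Qed.

(** Equal values at the two ends of the interval repair the jump of the angle at the base point. *)
Lemma continuous_angle (V Y : topologicalType) (f : I * V -> Y) :
  continuous f ->
  (forall v, f (endpoint R false, v) = f (endpoint R true, v)) ->
  continuous (fun p : V * circle R => f (circle_angle p.2, p.1)).
Proof.
move=> cf f01.
have cp : continuous (fun p : V * circle R => \val p.2 : R * R).
  apply: continuous_compose; first exact: continuous_snd.
  exact: initial_continuous.
have cx : continuous (fun p : V * circle R => (\val p.2).1).
  exact: (continuous_compose cp (@continuous_fst R R)).
have cy : continuous (fun p : V * circle R => (\val p.2).2).
  exact: (continuous_compose cp (@continuous_snd R R)).
have cc (h : V * circle R -> R) : continuous h ->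
    continuous (fun p : V * circle R => f (clamp (h p), p.1)).
  move=> ch; apply: (@continuous_compose _ _ _
    (fun p : V * circle R => (clamp (h p), p.1)) f) => //.
  apply: continuous_pair; last exact: continuous_fst.
  exact: (continuous_compose ch (@continuous_clamp R)).
apply: (@continuous_eq _ _ _ (fun p : V * circle R =>
   if (\val p.2).2 < 0 then f (clamp ((3 + (\val p.2).1) / 4), p.1)
   else f (clamp ((1 - (\val p.2).1) / 4), p.1))).
  by move=> p; rewrite /circle_angle /plane_angle; case: ifP.
apply: continuous_if => //; first exact: continuous_cst.
- apply: cc; apply: continuous_mul; last exact: continuous_cst.
  by apply: continuous_add; first exact: continuous_cst.
- apply: cc; apply: continuous_mul; last exact: continuous_cst.
  by apply: continuous_sub; first exact: continuous_cst.
- move=> [v [[x y] xy]] /= y0.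
  have {xy} : x ^+ 2 + y ^+ 2 = 1 by move: xy; rewrite inE.
  (* The half-circles meet at x = 1, handled by [f01], and at x = -1, where both parameters are
     1/2. *)
  rewrite y0 expr0n addr0 => /eqP; rewrite sqrf_eq1 => /orP[] /eqP ->.
    rewrite clamp_ge1 ?clamp_le0 ?f01 //; lra.
  by congr (f (clamp _, v)); lra.
Qed.

End CircleParameter.

(** * The wedge of circles as the orbit space of the tree *)

Section Bouquet.
Variables (R : realType) (m : nat).
Local Notation S := 'I_m.+1.
Local Notation F := (free_group S).
Local Notation X := (free_rack S).
Local Notation B := (rack_space R X).
Local Notation T := (tree R S).
Local Notation I := (unit_interval R).
Local Notation W := (wedge (fun _ : S => circle_base R)).
Local Notation on_circle s :=
  (@wedge_lift S (fun=> circle R) (fun=> circle_base R) s).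

Definition petal (s : S) (u : I) : W := on_circle s (loop u).

Lemma petal_endpoint s e :
  petal s (endpoint R e) = petal ord0 (endpoint R false).
Proof.
rewrite /petal !loop_endpoint.
exact: (@wedge_liftE _ (fun=> circle R) (fun=> circle_base R)
  _ (circle_base R) _ (circle_base R)).
Qed.

Lemma continuous_petal s : continuous (petal s).
Proof.
apply: (continuous_compose (@continuous_loop R)).
exact: (@wedge_lift_continuous _ (fun=> circle R)).
Qed.

(** The projection of the tree onto its orbit space: it forgets the group element. The index [ord0]
    merely names the common base point. *)
Definition tree_petal : T -> W :=
  tree_lift (fun (_ : F) o u =>
    if o is Some s then petal s u else petal ord0 (endpoint R false)).

Lemma tree_petal_point a o u : tree_petal (tree_point a o u) =
  if o is Some s then petal s u else petal ord0 (endpoint R false).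
Proof. by apply: tree_liftE => [_ [s|]|_ [s|]|] //; rewrite petal_endpoint. Qed.

Definition circle_edge (s : S) (u : I) : B :=
  rack_point (fsnoc (fempty S) (s, 1%g : F)) (csnoc (cempty R) u).

Lemma circle_edge_endpoint s e :
  circle_edge s (endpoint R e) = rack_point (fempty S) (cempty R).
Proof.
rewrite /circle_edge -coface_max -rack_point_face.
by congr rack_point; exact: ffun_empty.
Qed.

Lemma continuous_circle_edge s : continuous (circle_edge s).
Proof.
apply: (@continuous_compose _ _ _ (fun u => csnoc (cempty R) u) (rack_point _));
  last exact: rack_point_continuous.
apply: (@continuous_compose _ _ _ (fun u : I => (cempty R, u))
    (fun p => csnoc p.1 p.2));
  last exact: csnoc_continuous.
by apply: continuous_pair; [exact: continuous_cst|exact: continuous_id].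
Qed.

Definition wedge_edge : W -> B :=
  wedge_fun (fun s p => circle_edge s (circle_angle p)).

Lemma wedge_edge_base (s s' : S) :
  circle_edge s (circle_angle (circle_base R)) =
  circle_edge s' (circle_angle (circle_base R)).
Proof. by rewrite circle_angle_base !circle_edge_endpoint. Qed.

Lemma wedge_edge_lift s (p : circle R) :
  wedge_edge (on_circle s p) =
  circle_edge s (circle_angle p).
Proof. by apply: wedge_lift_funE => *; exact: wedge_edge_base. Qed.

Lemma wedge_edge_petal s u : wedge_edge (petal s u) = circle_edge s u.
Proof.
by rewrite wedge_edge_lift; apply: angle_loop; rewrite !circle_edge_endpoint.
Qed.

Lemma continuous_wedge_edge : continuous wedge_edge.
Proof.
apply: wedge_fun_continuous => [s|*]; last exact: wedge_edge_base.
apply: (@continuous_compose _ _ _ (fun p : circle R => (endpoint R false, p))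
  (fun p : I * circle R => circle_edge s (circle_angle p.2))).
  by apply: continuous_pair; [exact: continuous_cst|exact: continuous_id].
apply: (@continuous_angle R I B (fun p => circle_edge s p.1)).
  exact: (continuous_compose (@continuous_fst I I) (@continuous_circle_edge s)).
by move=> v; rewrite !circle_edge_endpoint.
Qed.

Lemma continuous_tree_petal : continuous tree_petal.
Proof.
apply: tree_continuous => a o.
apply: (continuous_eq (fun u => tree_petal_point a o u)).
by case: o => [s|]; [exact: continuous_petal|exact: continuous_cst].
Qed.

Lemma tree_petal_act b p : tree_petal (tree_act b p) = tree_petal p.
Proof.
have [a [o [u ->]]] := tree_pointP p.
by rewrite tree_act_point !tree_petal_point.
Qed.

Lemma wedge_edge_tree_petal p :
  wedge_edge (tree_petal p) = tree_family (fempty S) (cempty R) p.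
Proof.
have [a [o [u ->]]] := tree_pointP p.
rewrite tree_petal_point tree_family_point /tree_family_cell.
rewrite [ftranslate _ _]ffun_empty.
by case: o => [s|]; rewrite wedge_edge_petal // circle_edge_endpoint.
Qed.

(** For the entry [(s, 1)] the contraction is centred at the root and fixes it, so only the middle
    third moves, along the edge labelled s. The composite is thus a reparametrization of each petal,
    not the identity. *)
Lemma collapse_wedge_edge s p :
  collapse tree_petal (wedge_edge (on_circle s p)) =
  petal s (stretch (circle_angle p)).
Proof.
rewrite wedge_edge_lift collapseE; last exact: tree_petal_act.
rewrite /= fsnoc_last clast_snoc /slide /= /prune_from.
rewrite tree_act_vertex mulg1 !prune_root !tree_act_vertex.
have := stretchE (circle_angle p); case: ifP => _; last case: ifP => _.
- move=> e; rewrite tree_petal_point.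
  rewrite (_ : stretch _ = endpoint R false) ?petal_endpoint //.
  exact: val_inj.
- by move=> e; rewrite tree_petal_point -e clamp_val.
- move=> e; rewrite tree_petal_point.
  rewrite (_ : stretch _ = endpoint R true) ?petal_endpoint //.
  exact: val_inj.
Qed.

(** The straight-line homotopy from [stretch] to the identity; it fixes the endpoints, so it acts on
    every petal relative to the base point. *)
Definition unstretch (v u : I) : I :=
  clamp ((1 - \val v) * \val (stretch u) + \val v * \val u).

Lemma stretch_endpoint e : stretch (endpoint R e) = endpoint R e.
Proof.
rewrite /stretch; case: e => /=.
  by rewrite clamp_ge1 //; lra.
by rewrite clamp_le0 //; lra.
Qed.

Lemma unstretch_endpoint v e : unstretch v (endpoint R e) = endpoint R e.
Proof.
rewrite /unstretch stretch_endpoint -[RHS]clamp_val; congr clamp.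
by rewrite -mulrDl subrK mul1r.
Qed.

Lemma continuous_unstretch : continuous (fun p : I * I => unstretch p.2 p.1).
Proof.
have c1 : continuous (fun p : I * I => \val p.1).
  by apply: continuous_compose; [exact: continuous_fst|exact: continuous_val].
have c2 : continuous (fun p : I * I => \val p.2).
  by apply: continuous_compose; [exact: continuous_snd|exact: continuous_val].
have cs : continuous (fun p : I * I => \val (stretch p.1)).
  apply: (@continuous_compose _ _ _ (fun p : I * I => stretch p.1));
    last exact: continuous_val.
  exact: (continuous_compose (@continuous_fst I I) (@continuous_stretch R)).
apply: (continuous_compose (g := @clamp R)); last exact: continuous_clamp.
apply: continuous_add; apply: continuous_mul => //.
by apply: continuous_sub => //; exact: continuous_cst.
Qed.

Lemma closed_circle_base : closed [set circle_base R].
Proof.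
apply: accessible_closed_set1; apply: hausdorff_accessible => p q pq.
apply: val_inj; apply: (@norm_hausdorff R (R * R)%type) => U V pU qV.
have pU' : nbhs p (\val @^-1` U) by exact: initial_continuous.
have qV' : nbhs q (\val @^-1` V) by exact: initial_continuous.
by have [u []] := pq _ _ pU' qV'; exists (\val u).
Qed.

Lemma homotopic_wedge : homotopic R (collapse tree_petal \o wedge_edge) idfun.
Proof.
pose k (s : S) (v : I) (p : circle R) : W :=
  petal s (unstretch v (circle_angle p)).
have kb v s s' : k s v (circle_base R) = k s' v (circle_base R).
  rewrite /k circle_angle_base unstretch_endpoint.
  by rewrite petal_endpoint [RHS]petal_endpoint.
have ck s : continuous (uncurry (k s)).
  apply: (@continuous_eq _ _ _
    (fun p => petal s (unstretch p.1 (circle_angle p.2)))).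
    by case.
  apply: (@continuous_angle R I W (fun p => petal s (unstretch p.2 p.1))).
    exact: (continuous_compose continuous_unstretch (@continuous_petal s)).
  by move=> v; rewrite !unstretch_endpoint petal_endpoint [RHS]petal_endpoint.
(* Joint continuity on the wedge uses that there are finitely many circles and that their base
   points are closed. *)
have cK := wedge_fun_joint_continuous finite_finset
  (fun=> closed_circle_base) kb ck.
exists (fun p => wedge_fun (k^~ p.2) p.1); split.
- apply: (@continuous_compose _ _ _ (fun p : W * I => (p.2, p.1))
    (uncurry (fun t => wedge_fun (k^~ t)))) => //.
  by apply: continuous_pair; [exact: continuous_snd|exact: continuous_fst].
- move=> w; rewrite -[w]reprK; case: (repr w) => s p.
  rewrite [LHS](@wedge_lift_funE _ _ _ _ (k^~ _)) //.
  rewrite [RHS](collapse_wedge_edge p) /k /unstretch.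
  rewrite (_ : \val (endpoint R false) = 0) //.
  by rewrite subr0 mul1r mul0r addr0 clamp_val.
- move=> w; rewrite -[w]reprK; case: (repr w) => s p.
  rewrite [LHS](@wedge_lift_funE _ _ _ _ (k^~ _)) //.
  rewrite /k /unstretch (_ : \val (endpoint R true) = 1) //.
  by rewrite subrr mul0r mul1r add0r clamp_val /petal circle_angleK.
Qed.

End Bouquet.

Theorem theorem5p13 (R : realType) (n : nat) :
  homotopy_equivalent R (rack_space R (free_rack 'I_n)) (circle_wedge R n).
Proof.
case: n => [|m].
  (* With no generators the tree has no edges and the orbit space is a single point. *)
  pose g (_ : discrete_topology unit) : rack_space R (free_rack 'I_0) :=
    rack_point (fempty 'I_0) (cempty R).
  pose pr (_ : tree R 'I_0) : discrete_topology unit := tt.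
  apply: (@homotopy_equivalent_collapse R 'I_0 _ pr g) => //.
  - exact: continuous_cst.
  - exact: continuous_cst.
  - move=> p; have [a [o [u ->]]] := tree_pointP p; case: o => [[]//|].
    by rewrite tree_family_point /= [ftranslate _ _]ffun_empty.
  - exists fst; split => [|[]|[]] //; exact: continuous_fst.
apply: (@homotopy_equivalent_collapse _ _ _ (@tree_petal R m)
  (@wedge_edge R m)).
- exact: continuous_tree_petal.
- exact: continuous_wedge_edge.
- exact: tree_petal_act.
- exact: wedge_edge_tree_petal.
- exact: homotopic_wedge.
Qed.
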